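(* Let $\beta\in(1,2]$ and $L>0$ be known, let $K$ satisfy the kernel assumptions, let $\alpha\in(0,1)$, and let $(f_n)_{n\ge1}$ be functions in $\Sigma(\beta,L)$ with $\varepsilon_{1,\gamma_n}(f_n)\ge2/n$, where $\gamma_n=C_\beta h_n^{\beta-1}$. Assume additionally that $D_{\gamma_n}(f_n)\cap[h_n+1/n,\,1-h_n-1/n]\ne\emptyset$, where $D_\gamma(f)=\{x\in[0,1]:f'(x)\le-\gamma\}$. Run FOMT with $C_n(\alpha)=-2\log(\alpha/2)/\varepsilon_{1,\gamma_n}(f_n)$. Then $\liminf_{n\to\infty}\mathbb P_{f_n}(\Phi=1)\ge1-\alpha$.
   Context: Model: $Y_i=f(x_i)+\varepsilon_i$, $i\in[n]=\{1,\dots,n\}$, $x_i=i/n$, $\varepsilon_i$ i.i.d. $\mathcal N(0,\sigma^2)$ with known $\sigma>0$; $\mathbb P_f$ the law under $f$. $\Sigma(\beta,L)$ ($1<\beta\le2$): differentiable $f$ with $|f'(x)-f'(y)|\le L|x-y|^{\beta-1}$. $\lambda$ Lebesgue measure; for continuously differentiable $f$ and $\gamma>0$, $\varepsilon_{1,\gamma}(f)=\lambda(\{x\in[0,1]:f'(x)\le-\gamma\})$. Kernel assumptions: $K\ge0$, $\int K=1$, support in $[-1,1]$, $K_{\min}\mathbf 1_{\{|u|\le\Delta\}}\le K\le K_{\max}$ for constants $K_{\min},K_{\max},\Delta>0$, $K$ Lipschitz with constant $L_K$, $K$ symmetric; $\mu_2=\int K^2$. LPE of order $k=\lceil\beta\rceil-1=1$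 with bandwidth $h$: $U(u)=(1,u)^\top$, $\mathcal B_{nx}=\frac1{nh}\sum_iU(\tfrac{x_i-x}h)U(\tfrac{x_i-x}h)^\top K(\tfrac{x_i-x}h)$, $\hat f_n(x)=\sum_iW_{ni}(x)Y_i$, $W_{ni}(x)=\frac1{nh}U(0)^\top\mathcal B_{nx}^{-1}U(\tfrac{x_i-x}h)K(\tfrac{x_i-x}h)$. $\lambda_0>0$ lower-bounds the smallest eigenvalue of $\mathcal B_{nx}$ for all $x$ and large $n$ (paper: $\lambda_0=0.0228$). Constants: $C_*=8K_{\max}/\lambda_0$, $q_1=C_*L$, $q_2=32\sigma^2\mu_2/\lambda_0^2$, $C_h=(q_2/(4q_1^2\beta))^{1/(2\beta+1)}$, $h_n=C_h(\log n/n)^{1/(2\beta+1)}$; $L_1=\sqrt e(K_{\max}+L_K)$, $L_2=4K_{\max}+2L_K$, $\widetilde C_*=L_1/(8L_2)+\sqrt eK_{\max}/\lambda_0$, $W=\max(4C_*^2,4\widetilde C_*^2)$; $C_\beta=4L+\frac{16L_2\sigma}{\lambda_0}\sqrt{4W/C_h^{2\beta+1}}$. FOMT: $N_{\max}=\frac{40}{\log2}C_n(\alpha)(\log n)^2$; $T_{i,j}=\hat f_n(x_i)-\hat f_n(x_j)$ (bandwidth $h_n$); $C_{n,\alpha,i,j}=\sigma\sqrt{-2\log(\alpha/N_{\max})W}\,n^{-1/2}h_n^{-3/2}(\tfrac{8L_2}{\lambda_0}|x_i-x_j|\wedge h_n)$; $D_{n,\beta,i,j}=0$ if $x_i,x_j\in[h_n,1-h_n]$,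 else $(\tfrac{16K_{\max}}{\lambda_0}\vee2)Lh_n^\beta$; $\Phi_{i,j}=\mathbf 1\{T_{i,j}\ge C_{n,\alpha,i,j}+D_{n,\beta,i,j}\}$. $\Phi$: repeat $C_n(\alpha)$ times: draw $I\sim\mathrm{Unif}([n])$; if $I\le n-1$, repeat $\lceil20\log n\rceil$ times: for $k=0,\dots,\lceil\log_2(n-I)\rceil$ draw $J_k\sim\mathrm{Unif}\{1,\dots,\min(2^k,n-I)\}$, output $\Phi=1$ and stop if $\Phi_{I,I+J_k}=1$; if $I\ge2$, repeat $\lceil20\log n\rceil$ times: for $k=0,\dots,\lceil\log_2(I-1)\rceil$ draw $J'_k\sim\mathrm{Unif}\{1,\dots,\min(2^k,I-1)\}$, output $\Phi=1$ and stop if $\Phi_{I-J'_k,I}=1$; otherwise output $\Phi=0$. Draws independent of each other and of the data. *)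

(* Defs.v *)
From HB Require Import structures.
From mathcomp Require Import all_boot all_order all_algebra.
From mathcomp Require Import all_classical all_reals all_analysis.
Set Implicit Arguments. Unset Strict Implicit. Unset Printing Implicit Defensive.
Import Order.TTheory GRing.Theory Num.Theory Num.Def.
Import numFieldNormedType.Exports.
Local Open Scope classical_set_scope.
Local Open Scope ring_scope.

Section FOMT.
Variable R : realType.

Record params := Params {
  K : R -> R;
  Kmin : R; Kmax : R; Delta : R; LK : R;
  sigma : R;
  beta : R; L : R;
  lambda0 : R;
  alpha : R
}.

Variable p : params.

Definition kernel_assumptions : Prop :=
  (forall u, 0 <= K p u) /\
  (\int[lebesgue_measure]_u (K p u)%:E = 1)%E /\
  (forall u, 1 < `|u| -> K p u = 0) /\
  (0 < Kmin p /\ 0 < Kmax p /\ 0 < Delta p) /\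
  (forall u, Kmin p * (if `|u| <= Delta p then 1 else 0) <= K p u /\ K p u <= Kmax p) /\
  (0 <= LK p /\ forall u v, `|K p u - K p v| <= LK p * `|u - v|) /\
  (forall u, K p (- u) = K p u).

Definition mu2 : R := \int[lebesgue_measure]_u (K p u ^+ 2).

Definition Hoelder_class (f : R -> R) : Prop :=
  (forall x, derivable f x 1) /\
  (forall x y, x \in `[0, 1] -> y \in `[0, 1] ->
     `|derive1 f x - derive1 f y| <= L p * `|x - y| `^ (beta p - 1)).

Definition Dset (gamma : R) (f : R -> R) : set R :=
  [set x | x \in `[0, 1] /\ derive1 f x <= - gamma].
Definition eps1 (gamma : R) (f : R -> R) : \bar R :=
  lebesgue_measure (Dset gamma f).

Definition xpt (n i : nat) : R := i%:R / n%:R.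

(* Local polynomial estimator of order 1 *)
Definition Uvec (u : R) : 'cV[R]_2 := \col_(k < 2) (if k == ord0 then 1 else u).

Definition Bmat (n : nat) (h x : R) : 'M[R]_2 :=
  (n%:R * h)^-1 *: \sum_(1 <= i < n.+1)
     (K p ((xpt n i - x) / h) *: (Uvec ((xpt n i - x) / h) *m (Uvec ((xpt n i - x) / h))^T)).

Definition Wn (n : nat) (h x : R) (i : nat) : R :=
  (n%:R * h)^-1 *
  ((Uvec 0)^T *m invmx (Bmat n h x) *m Uvec ((xpt n i - x) / h)) ord0 ord0
  * K p ((xpt n i - x) / h).

Definition fhat (n : nat) (h : R) (Y : nat -> R) (x : R) : R :=
  \sum_(1 <= i < n.+1) Wn n h x i * Y i.

Definition Cstar : R := 8 * Kmax p / lambda0 p.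
Definition q1 : R := Cstar * L p.
Definition q2 : R := 32 * sigma p ^+ 2 * mu2 / lambda0 p ^+ 2.
Definition Ch : R := (q2 / (4 * q1 ^+ 2 * beta p)) `^ (2 * beta p + 1)^-1.
Definition hn (n : nat) : R := Ch * (ln n%:R / n%:R) `^ (2 * beta p + 1)^-1.
Definition L1 : R := Num.sqrt (expR 1) * (Kmax p + LK p).
Definition L2 : R := 4 * Kmax p + 2 * LK p.
Definition Ctilde : R := L1 / (8 * L2) + Num.sqrt (expR 1) * Kmax p / lambda0 p.
Definition Wc : R := Num.max (4 * Cstar ^+ 2) (4 * Ctilde ^+ 2).
Definition Cbeta : R :=
  4 * L p + 16 * L2 * sigma p / lambda0 p * Num.sqrt (4 * Wc / Ch `^ (2 * beta p + 1)).
Definition gamman (n : nat) : R := Cbeta * hn n `^ (beta p - 1).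

Definition lambda0_assumption : Prop :=
  0 < lambda0 p /\
  exists N : nat, forall n : nat, (N <= n)%N -> forall x : R, x \in `[0, 1] ->
    forall a : R, eigenvalue (Bmat n (hn n) x) a -> lambda0 p <= a.

Definition Nmax (n : nat) (Cn : R) : R := 40 / ln 2 * Cn * (ln n%:R) ^+ 2.

Definition Cthr (n : nat) (Cn : R) (i j : nat) : R :=
  sigma p * Num.sqrt (- 2 * ln (alpha p / Nmax n Cn) * Wc) * n%:R `^ (- 2^-1)
  * hn n `^ (- (3 / 2)) * Num.min (8 * L2 / lambda0 p * `|xpt n i - xpt n j|) (hn n).

Definition Dthr (n : nat) (i j : nat) : R :=
  if (xpt n i \in `[hn n, 1 - hn n]) && (xpt n j \in `[hn n, 1 - hn n]) then 0
  else Num.max (16 * Kmax p / lambda0 p) 2 * L p * hn n `^ beta p.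

Definition Phi_ij (n : nat) (Cn : R) (Y : nat -> R) (i j : nat) : bool :=
  Cthr n Cn i j + Dthr n i j <= fhat n (hn n) Y (xpt n i) - fhat n (hn n) Y (xpt n j).

(* Semantics of the randomized procedure Phi, written in continuation style:
   [unif_draw m g c] is the probability of never rejecting when J ~ Unif{1..m}
   is drawn, then the (J-dependent) step [g J] is run, then the remaining
   procedure whose non-rejection probability is c. *)
Definition ceil_nat (x : R) : nat := `|Num.ceil x|%N.
Definition log2 (x : R) : R := ln x / ln 2.

Definition unif_draw (m : nat) (g : nat -> R -> R) (c : R) : R :=
  (m%:R)^-1 * \sum_(1 <= j < m.+1) g j c.

Definition test (b : bool) (c : R) : R := if b then 0 else c.

Definition right_pass (n : nat) (Cn : R) (Y : nat -> R) (I : nat) (c : R) : R :=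
  foldr (fun k acc => unif_draw (minn (2 ^ k) (n - I))
                        (fun j c' => test (Phi_ij n Cn Y I (I + j)) c') acc)
        c (iota 0 (ceil_nat (log2 (n - I)%:R)).+1).

Definition left_pass (n : nat) (Cn : R) (Y : nat -> R) (I : nat) (c : R) : R :=
  foldr (fun k acc => unif_draw (minn (2 ^ k) (I - 1))
                        (fun j c' => test (Phi_ij n Cn Y (I - j) I) c') acc)
        c (iota 0 (ceil_nat (log2 (I - 1)%:R)).+1).

Definition nrep (n : nat) : nat := ceil_nat (20 * ln n%:R).

Definition outer_step (n : nat) (Cn : R) (Y : nat -> R) (c : R) : R :=
  unif_draw n (fun I c' =>
    (if (I <= n - 1)%N then iter (nrep n) (right_pass n Cn Y I) else id)
    ((if (2 <= I)%N then iter (nrep n) (left_pass n Cn Y I) else id) c')) c.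

Definition prob_accept (n : nat) (Cn : R) (Y : nat -> R) : R :=
  iter (ceil_nat Cn) (outer_step n Cn Y) 1.

(* Expectation over independent Y_i ~ N(mean i, sigma^2), i = 1..k,
   as iterated Lebesgue integrals against the normal law. *)
Definition upd (Y : nat -> R) (i : nat) (y : R) : nat -> R :=
  fun j => if j == i then y else Y j.

Fixpoint gauss_expect (mean : nat -> R) (k : nat) (g : (nat -> R) -> R) : R :=
  match k with
  | 0 => g (fun _ => 0)
  | k'.+1 => fine (\int[normal_prob (mean k) (sigma p)]_y
                   (gauss_expect mean k' (fun Y => g (upd Y k y)))%:E)%E
  end.

Definition prob_reject (f : R -> R) (n : nat) (Cn : R) : R :=
  gauss_expect (fun i => f (xpt n i)) n (fun Y => 1 - prob_accept n Cn Y).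

End FOMT.

(* Main.v *)
Require Import Defs.
From HB Require Import structures.
From mathcomp Require Import all_boot all_order all_algebra.
From mathcomp Require Import all_classical all_reals all_analysis.
From mathcomp Require Import measurable_realfun.
From mathcomp Require Import ring lra zify.
Import Order.TTheory GRing.Theory Num.Theory Num.Def.
Import numFieldNormedType.Exports.
Local Open Scope classical_set_scope.
Local Open Scope ring_scope.

(** The first draw of every pass is uniform on {1}, so an outer iteration
    rejects as soon as the sampled index I satisfies Phi_{I,I+1} = 1; only
    adjacent pairs are needed.  Call I a candidate if x_I and x_{I+1} are
    interior and x_I is within 5h_n/2 of the set D where f' <= -gamma_n.
    Candidates cover the interior part of D, and the interior point of D alone
    produces at least 2nh_n+2 of them, so there are at least n eps/2 of them.

    At interior grid points the design is symmetric: the estimator is a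
    convolution with K, whose shift by one grid step transfers to f.  Hence
    E T_{I,I+1} is at least twice the threshold, whereas Var T_{I,I+1} is
    smaller than the square of the threshold by a factor of order log n, and a
    Chernoff bound makes Phi_{I,I+1} = 0 improbable for each candidate.

    If F is the fraction of candidates with Phi_{I,I+1} = 0, the conditional
    acceptance probability is at most (alpha/2)^(1-F) <= alpha/2 + F by
    convexity, which is linear in F, so no union bound is needed. *)

(** * Iterated Gaussian expectations *)

(* Holds without measurability: the integral of a nonnegative function is a
   supremum over the simple functions below it. *)
Lemma ge0_le_integral_nonmeas d (T : measurableType d) (R : realType)
    (mu : {measure set T -> \bar R}) (f g : T -> \bar R) :
  (forall x, (0 <= f x)%E) -> (forall x, (f x <= g x)%E) ->
  (\int[mu]_x f x <= \int[mu]_x g x)%E.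
Proof.
move=> f0 fg.
have g0 x : (0 <= g x)%E by exact: le_trans (fg x).
rewrite !ge0_integralTE//.
apply: ereal_sup_le => _ [h /= hf <-].
by exists h => //= x; exact: le_trans (fg x).
Qed.

(** The Radon-Nikodym derivative and the normal density have equal integrals over all measurable
    sets, hence agree almost everywhere. *)
Lemma ge0_integral_normal_prob (R : realType) (m s : R)
    (f : measurableTypeR R -> \bar R) :
  measurable_fun [set: measurableTypeR R] f -> (forall x, (0 <= f x)%E) ->
  (\int[normal_prob m s]_x f x =
   \int[lebesgue_measure]_x (f x * (normal_pdf m s x)%:E))%E.
Proof.
move=> mf f0.
have dom := @normal_prob_dominates R m s.
rewrite -(Radon_Nikodym_SigmaFinite.change_of_variables dom)//.
apply: ae_eq_integral => //.
- apply: emeasurable_funM => //; apply: (measurable_int lebesgue_measure).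
  exact: Radon_Nikodym_SigmaFinite.f_integrable.
- apply: emeasurable_funM => //; apply/measurable_EFinP.
  exact: measurable_normal_pdf.
- apply: ae_eqe_mul2l => /=; apply: integral_ae_eq => //=.
  + exact: Radon_Nikodym_SigmaFinite.f_integrable.
  + by apply/measurable_EFinP; exact: measurable_normal_pdf.
  + by move=> E _ mE; rewrite -Radon_Nikodym_SigmaFinite.f_integral.
Qed.

(* Exponential tilting only shifts the mean of a normal density. *)
Lemma expR_normal_pdf (R : realType) (m s t x : R) : s != 0 ->
  expR (t * (x - m)) * normal_pdf m s x =
  expR (t ^+ 2 * s ^+ 2 / 2) * normal_pdf (m + t * s ^+ 2) s x.
Proof.
move=> s0; rewrite !normal_pdfE// !(mulrCA (expR _)); congr (_ * _).
rewrite /normal_fun -!expRD; congr expR.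
by field.
Qed.

Lemma integral_expR_normal_prob (R : realType) (m s t : R) : s != 0 ->
  (\int[normal_prob m s]_x (expR (t * (x - m)))%:E =
   (expR (t ^+ 2 * s ^+ 2 / 2))%:E)%E.
Proof.
move=> s0; rewrite ge0_integral_normal_prob; last 2 first.
- apply/measurable_EFinP; apply: measurableT_comp => //.
  by apply: measurable_funM => //; exact: measurable_funB.
- by move=> x; rewrite lee_fin expR_ge0.
under eq_integral do rewrite -EFinM expR_normal_pdf// EFinM.
rewrite ge0_integralZl//; first by rewrite integral_normal_pdf mule1.
- by apply/measurable_EFinP; exact: measurable_normal_pdf.
- by move=> x _; rewrite lee_fin normal_pdf_ge0.
Qed.

(** The minorant is measurable and its integral is a sum of Gaussian exponential moments; [g] enters
    only by comparison. *)
Lemma le_integral_sub_sum_expR (R : realType) (m s a : R) (J : seq nat)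
    (c w : nat -> R) (g : R -> R) :
  s != 0 -> 0 <= a -> (forall y, 0 <= g y <= 1) -> (forall j, 0 <= c j) ->
  (forall y, a - \sum_(j <- J) c j * expR (w j * (y - m)) <= g y) ->
  a - \sum_(j <- J) c j * expR (w j ^+ 2 * s ^+ 2 / 2) <=
    fine (\int[normal_prob m s]_y (g y)%:E).
Proof.
move=> s0 a0 g01 c0 ag.
pose H y := \sum_(j <- J) c j * expR (w j * (y - m)).
have H0 y : 0 <= H y by apply: sumr_ge0 => j _; rewrite mulr_ge0 ?expR_ge0.
have mE j : measurable_fun [set: R] (fun y : R => expR (w j * (y - m))).
  apply: measurableT_comp => //.
  by apply: measurable_funM => //; exact: measurable_funB.
have mH : measurable_fun [set: R] H.
  exact: (@measurable_sum _ (measurableTypeR R) R setT nat J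
    (fun j y => c j * expR (w j * (y - m))) (fun j => measurable_funM _ (mE j))).
have intH : (\int[normal_prob m s]_y (H y)%:E =
    (\sum_(j <- J) c j * expR (w j ^+ 2 * s ^+ 2 / 2))%:E)%E.
  under eq_integral do rewrite -sumEFin.
  rewrite ge0_integral_sum//; last 2 first.
  - by move=> j; apply/measurable_EFinP; exact: (measurable_funM _ (mE j)).
  - by move=> j y _; rewrite lee_fin mulr_ge0 ?expR_ge0.
  rewrite -sumEFin; apply: eq_bigr => j _.
  under eq_integral do rewrite EFinM.
  rewrite ge0_integralZl//; first by rewrite integral_expR_normal_prob.
  - by apply/measurable_EFinP; exact: mE.
  - by rewrite lee_fin.
(* Truncation at 0 makes the minorant nonnegative, hence comparable with [g]; as [a <= P + H], its
   integral is still at least [a] minus that of [H]. *)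
pose P y := Num.max 0 (a - H y).
have mP : measurable_fun [set: R] P.
  by apply: measurable_maxr => //; exact: measurable_funB.
have P0 y : 0 <= P y by rewrite /P le_max lexx.
have intPg : (\int[normal_prob m s]_y (P y)%:E <=
    \int[normal_prob m s]_y (g y)%:E)%E.
  apply: ge0_le_integral_nonmeas => y; rewrite lee_fin//.
  by have /andP[? _] := g01 y; rewrite ge_max; apply/andP; split => //; exact: ag.
have cst1 r : (\int[normal_prob m s]_y r%:E = r%:E)%E.
  by rewrite integral_cst//= probability_setT mule1.
have intg1 : (\int[normal_prob m s]_y (g y)%:E <= 1%:E)%E.
  rewrite -(cst1 1); apply: ge0_le_integral_nonmeas => y; rewrite lee_fin;
    by case/andP: (g01 y).
have intg0 : (0 <= \int[normal_prob m s]_y (g y)%:E)%E.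
  by apply: integral_ge0 => y _; rewrite lee_fin; case/andP: (g01 y).
rewrite -lee_fin fineK; last first.
  by rewrite ge0_fin_numE// (le_lt_trans intg1)// ltry.
apply: le_trans intPg.
rewrite EFinB leeBlDr// -intH -ge0_integralD//; last 4 first.
- by move=> y _; rewrite lee_fin.
- exact/measurable_EFinP.
- by move=> y _; rewrite lee_fin.
- exact/measurable_EFinP.
rewrite -(cst1 a); apply: ge0_le_integral_nonmeas => y; rewrite lee_fin//.
by rewrite -lerBlDr /P le_max lexx orbT.
Qed.

Lemma gauss_expect_itv01 (R : realType) (p : params R) (mean : nat -> R)
    (k : nat) (g : (nat -> R) -> R) :
  (forall Y, 0 <= g Y <= 1) -> 0 <= gauss_expect p mean k g <= 1.
Proof.
elim: k g => [|k IH] g g01 /=; first exact: g01.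
have G01 y : 0 <= gauss_expect p mean k (fun Y => g (upd Y k.+1 y)) <= 1.
  exact: IH.
have i0 : (0 <= \int[normal_prob (mean k.+1) (sigma p)]_y
    (gauss_expect p mean k (fun Y => g (upd Y k.+1 y)))%:E)%E.
  by apply: integral_ge0 => y _; rewrite lee_fin; case/andP: (G01 y).
have i1 : (\int[normal_prob (mean k.+1) (sigma p)]_y
    (gauss_expect p mean k (fun Y => g (upd Y k.+1 y)))%:E <= 1)%E.
  rewrite [leRHS](_ : _ = \int[normal_prob (mean k.+1) (sigma p)]_y (cst 1 y))%E.
    by apply: ge0_le_integral_nonmeas => y; rewrite lee_fin; case/andP: (G01 y).
  by rewrite integral_cst//= probability_setT mule1.
rewrite fine_ge0//= -lee_fin fineK// ge0_fin_numE//.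
by rewrite (le_lt_trans i1)// ltry.
Qed.

(** Bounds of the form constant minus a sum of exponentials of linear forms are stable under
    integrating out one coordinate, which fits the iterated definition of the expectation. *)
Lemma gauss_expect_ge (R : realType) (p : params R) (mean : nat -> R)
    (k : nat) (g : (nat -> R) -> R) (a : R) (J : seq nat) (c : nat -> R)
    (w : nat -> nat -> R) :
  sigma p != 0 -> 0 <= a -> (forall Y, 0 <= g Y <= 1) ->
  (forall j, 0 <= c j) ->
  (forall Y, a - \sum_(j <- J)
     c j * expR (\sum_(1 <= i < k.+1) w j i * (Y i - mean i)) <= g Y) ->
  a - \sum_(j <- J)
     c j * expR (sigma p ^+ 2 / 2 * \sum_(1 <= i < k.+1) w j i ^+ 2) <=
  gauss_expect p mean k g.
Proof.
move=> s0 a0; elim: k g c => [|k IH] g c g01 c0 ag /=.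
  apply: le_trans (ag _); rewrite lerB// ler_sum// => j _.
  by rewrite !big_geq// mulr0.
(* Factor left by the inner coordinates 1 to k; the outer integral is then bounded with coefficients
   [c j * v j]. *)
pose v j := expR (sigma p ^+ 2 / 2 * \sum_(1 <= i < k.+1) w j i ^+ 2).
have v0 j : 0 <= c j * v j by rewrite mulr_ge0 ?expR_ge0.
have G01 y : 0 <= gauss_expect p mean k (fun Y => g (upd Y k.+1 y)) <= 1.
  exact: gauss_expect_itv01.
apply: (le_trans _ (@le_integral_sub_sum_expR R (mean k.+1) (sigma p) a J
  (fun j => c j * v j) (w^~ k.+1) _ s0 a0 G01 v0 _)) => [|y].
  rewrite lerB// ler_sum// => j _.
  rewrite -[c j * v j * _]mulrA /v -expRD ler_wpM2l// ler_expR.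
  rewrite [\sum_(1 <= i < k.+2) _]big_nat_recr//= mulrDr lerD2l.
  by rewrite [leRHS]mulrC [leRHS]mulrA.
rewrite (eq_bigr (fun j => c j * expR (w j k.+1 * (y - mean k.+1)) * v j)); last first.
  by move=> j _; rewrite mulrAC.
apply: IH => [Y|j|Y]; [exact: g01|by rewrite mulr_ge0 ?expR_ge0|].
apply: le_trans (ag _); rewrite lerB// ler_sum// => j _.
rewrite -mulrA -expRD ler_wpM2l// ler_expR big_nat_recr//= addrC /upd eqxx.
rewrite lerD2l le_eqVlt; apply/orP; left; apply/eqP.
by apply: eq_big_nat => i /andP[_ ik]; rewrite ltn_eqF.
Qed.

(** * The randomized procedure *)

Lemma ceil_nat_ge (R : realType) (x : R) : x <= (ceil_nat x)%:R.
Proof.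
apply: le_trans (ceil_ge x) _.
by rewrite /ceil_nat pmulrn ler_int abszE ler_norm.
Qed.

Lemma ceil_nat_lt (R : realType) (x : R) : 0 <= x -> (ceil_nat x)%:R < x + 1.
Proof.
move=> x0; have c0 : 0 <= Num.ceil x by rewrite ceil_ge0 (lt_le_trans _ x0)// ltrN10.
rewrite /ceil_nat pmulrn abszE ger0_norm// -ltrBlDr.
by rewrite -[X in _ - X]/(1%:~R) -intrB -ceil_gt_int ltrBlDr ltrDl.
Qed.

Section Acceptance.
Variables (R : realType) (p : params R).
Implicit Types (n I m : nat) (c Cn : R) (Y : nat -> R).

(** In continuation style, further tests can only lower the non-rejection probability; this is what
    allows all but the decisive draws to be discarded. *)
Lemma unif_draw_itv m (g : nat -> R -> R) c : 0 <= c ->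
  (forall j, 0 <= g j c <= c) -> 0 <= unif_draw m g c <= c.
Proof.
move=> c0 gc; rewrite /unif_draw.
have [->|m0] := posnP m; first by rewrite big_geq// mulr0 lexx.
have mR : 0 < m%:R :> R by rewrite ltr0n.
apply/andP; split.
  by rewrite mulr_ge0 ?invr_ge0 ?ler0n// sumr_ge0// => j _; case/andP: (gc j).
rewrite mulrC ler_pdivrMr// mulrC.
apply: le_trans (_ : \sum_(1 <= j < m.+1) c <= _).
  by apply: ler_sum => j _; case/andP: (gc j).
by rewrite sumr_const_nat subSS subn0 mulr_natl.
Qed.

Lemma test_itv b c : 0 <= c -> 0 <= test b c <= c.
Proof. by move=> c0; rewrite /test; case: b; rewrite lexx ?c0. Qed.

Lemma foldr_unif_draw_itv (m : nat -> nat) (b : nat -> bool) c (s : seq nat) :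
  0 <= c ->
  0 <= foldr (fun k acc => unif_draw (m k) (fun j c' => test (b j) c') acc)
         c s <= c.
Proof.
move=> c0; elim: s => [|k s /andP[IH0 IH1]] /=; first by rewrite c0 lexx.
set r := foldr _ _ _ in IH0 IH1 *.
have /andP[-> h] : 0 <= unif_draw (m k) (fun j c' => test (b j) c') r <= r.
  by apply: unif_draw_itv => // j; exact: test_itv.
exact: le_trans IH1.
Qed.

Lemma right_pass_itv n Cn Y I c :
  0 <= c -> 0 <= right_pass p n Cn Y I c <= c.
Proof. exact: foldr_unif_draw_itv. Qed.

Lemma left_pass_itv n Cn Y I c :
  0 <= c -> 0 <= left_pass p n Cn Y I c <= c.
Proof. exact: foldr_unif_draw_itv. Qed.

Lemma iter_itv (h : R -> R) k c :
  (forall x, 0 <= x -> 0 <= h x <= x) -> 0 <= c -> 0 <= iter k h c <= c.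
Proof.
move=> hx c0; elim: k => [|k /andP[IH0 IH1]] /=; first by rewrite c0 lexx.
by have /andP[-> h1] := hx _ IH0; exact: le_trans IH1.
Qed.

(* The first draw of a pass is uniform on {1}, so the pass always examines the
   pair (I, I+1). *)
Lemma right_pass_eq0 n Cn Y I c : (I < n)%N ->
  Phi_ij p n Cn Y I I.+1 -> right_pass p n Cn Y I c = 0.
Proof.
move=> In PhiI; rewrite /right_pass /= {1}/unif_draw expn0.
have -> : minn 1 (n - I) = 1%N by apply/minn_idPl; rewrite subn_gt0.
by rewrite big_nat1 addn1 /test PhiI mulr0.
Qed.

Lemma nrep_gt0 n : (1 < n)%N -> (0 < nrep R n)%N.
Proof.
move=> n1; rewrite /nrep /ceil_nat absz_gt0 gt_eqF//.
by rewrite ceil_gt_int mulr0z mulr_gt0// ln_gt0// ltr1n.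
Qed.

Lemma outer_step_itv n Cn Y c : 0 <= c -> 0 <= outer_step p n Cn Y c <= c.
Proof.
move=> c0; apply: unif_draw_itv => // I.
have L0 : 0 <= (if (2 <= I)%N then iter (nrep R n) (left_pass p n Cn Y I)
    else id) c <= c.
  case: ifP => _; last by rewrite c0 lexx.
  by apply: iter_itv => // x; exact: left_pass_itv.
move: L0; set d := (X in X c) => /andP[d0 dc].
case: ifP => _; last by rewrite d0.
have /andP[-> h] : 0 <= iter (nrep R n) (right_pass p n Cn Y I) (d c) <= d c.
  by apply: iter_itv => // x; exact: right_pass_itv.
exact: le_trans dc.
Qed.

(** A sampled I with Phi_{I,I+1} = 1 contributes 0 to the average over I, any other index at most
    [c]. *)
Lemma outer_step_le n Cn Y c : (1 < n)%N -> 0 <= c ->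
  outer_step p n Cn Y c <=
  (1 - (\sum_(1 <= I < n) (Phi_ij p n Cn Y I I.+1)%:R) / n%:R) * c.
Proof.
move=> n1 c0; have n0 : 0 < n%:R :> R by rewrite ltr0n (ltn_trans _ n1).
rewrite /outer_step /unif_draw mulrC ler_pdivrMr// mulrAC mulrBl mul1r.
rewrite divfK ?gt_eqF//.
have L0 I : 0 <= (if (2 <= I)%N then iter (nrep R n) (left_pass p n Cn Y I)
    else id) c <= c.
  case: ifP => _; last by rewrite c0 lexx.
  by apply: iter_itv => // x; exact: left_pass_itv.
(* The index n has no right neighbour; it is split off and counted as accepting. *)
rewrite big_nat_recr ?(ltnW n1)//=.
have -> : n%:R - \sum_(1 <= I < n) (Phi_ij p n Cn Y I I.+1)%:R =
    \sum_(1 <= I < n) (1 - (Phi_ij p n Cn Y I I.+1)%:R) + 1 :> R.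
  rewrite sumrB sumr_const_nat natrB ?(ltnW n1)//; set s := \sum_(_ <= _ < _) _.
  by rewrite addrAC subrK.
rewrite mulrDl mul1r lerD//; last first.
  have -> : (n <= n - 1)%N = false by lia.
  by case/andP: (L0 n).
rewrite mulr_suml; apply: ler_sum_nat => I /andP[I1 In].
have -> : (I <= n - 1)%N by lia.
move: (L0 I); set d := (if (1 < I)%N then _ else _) => /andP[d0 dc].
have [PhiI|PhiI] := boolP (Phi_ij p n Cn Y I I.+1); rewrite /= ?subrr ?mul0r ?subr0 ?mul1r.
  case: (nrep R n) (nrep_gt0 _ n1) => // k _ /=.
  by rewrite right_pass_eq0.
have /andP[_ h] : 0 <= iter (nrep R n) (right_pass p n Cn Y I) (d c) <= d c.
  by apply: iter_itv => // x; exact: right_pass_itv.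
exact: le_trans dc.
Qed.

Lemma prob_accept_itv01 n Cn Y : 0 <= prob_accept p n Cn Y <= 1.
Proof. by apply: iter_itv => // x; exact: outer_step_itv. Qed.

(** Each iteration multiplies by at most 1 - x <= exp(-x), and rounding the number of iterations up
    only helps because x >= 0. *)
Lemma prob_accept_le_expR n Cn Y : (1 < n)%N ->
  prob_accept p n Cn Y <=
  expR (- (Cn * ((\sum_(1 <= I < n) (Phi_ij p n Cn Y I I.+1)%:R) / n%:R))).
Proof.
move=> n1; set x := _ / n%:R.
have x0 : 0 <= x.
  by rewrite divr_ge0// sumr_ge0// => I _; rewrite ler0n.
have acc k : 0 <= iter k (outer_step p n Cn Y) 1 <= expR (- (k%:R * x)).
  elim: k => [|k /andP[IH0 IH1]] /=; first by rewrite mul0r oppr0 expR0 ler01 lexx.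
  have /andP[-> _] := outer_step_itv n Cn Y _ IH0.
  apply: le_trans (outer_step_le n Cn Y _ n1 IH0) _.
  rewrite -natr1 [(_ + 1) * x]mulrDl mul1r opprD expRD mulrC.
  apply: le_trans (_ : iter k (outer_step p n Cn Y) 1 * expR (- x) <= _).
    by rewrite ler_wpM2l// expR_ge1Dx.
  by rewrite ler_wpM2r// expR_ge0.
rewrite /prob_accept; have /andP[_] := acc (ceil_nat Cn).
move=> /le_trans; apply; rewrite ler_expR lerN2 ler_wpM2r//.
exact: ceil_nat_ge.
Qed.

(** On [0,1] the convex function v -> exp(-kv) lies below its chord, whose value at v = 1 - u is u +
    (1 - u) exp(-k). *)
Lemma expR_chord (k u : R) : 0 <= k -> 0 <= u <= 1 ->
  expR (- (k * (1 - u))) <= expR (- k) + u.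
Proof.
move=> k0 /andP[u0 u1].
have v0 : 0 <= 1 - u by rewrite subr_ge0.
have v1 : 1 - u <= 1 by rewrite gerBl.
have := @convex_expR R (Itv01 v0 v1) (- k) 0.
rewrite !convRE /= /unstable.onem mulr0 addr0 expR0 mulr1 subKr mulrN [_ * k]mulrC.
move=> /le_trans; apply; rewrite lerD2r mulrBl mul1r gerBl.
by rewrite mulr_ge0 ?expR_ge0.
Qed.

End Acceptance.

(** * Rejection probability from the mean and variance of adjacent contrasts *)

Definition contrast_weight (R : realType) (p : params R) (n I i : nat) : R :=
  Wn p n (hn p n) (xpt R n I) i - Wn p n (hn p n) (xpt R n I.+1) i.
Arguments contrast_weight {R}.

Lemma fhat_contrast (R : realType) (p : params R) (n I : nat) (Y : nat -> R) :
  fhat p n (hn p n) Y (xpt R n I) - fhat p n (hn p n) Y (xpt R n I.+1) =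
  \sum_(1 <= i < n.+1) contrast_weight p n I i * Y i.
Proof.
by rewrite /fhat -sumrB; apply: eq_bigr => i _; rewrite -mulrBl.
Qed.

(** With F the failing fraction of [S], there are |S|(1 - F) rejecting indices, so acceptance has
    probability at most a^(1-F); the chord bound makes this linear in F. *)
Lemma prob_accept_le_failures (R : realType) (p : params R) (n : nat) (Cn a : R)
    (P : pred nat) (S := [seq I <- index_iota 1 n | P I]) (Y : nat -> R) :
  (1 < n)%N -> 0 < a <= 1 -> 0 < (size S)%:R :> R ->
  - ln a <= Cn * ((size S)%:R / n%:R) ->
  prob_accept p n Cn Y <=
  a + (size S)%:R^-1 * \sum_(I <- S) (~~ Phi_ij p n Cn Y I I.+1)%:R.
Proof.
move=> n1 /andP[a0 a1] S0 CnS.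
have n0 : 0 < n%:R :> R by rewrite ltr0n (ltn_trans _ n1).
set F := _ * \sum_(I <- S) _.
have Fsum : \sum_(I <- S) (Phi_ij p n Cn Y I I.+1)%:R = (size S)%:R * (1 - F).
  rewrite mulrBr mulr1 /F mulVKf ?gt_eqF//.
  rewrite -sum1_size natr_sum -sumrB; apply: eq_bigr => I _.
  by case: (Phi_ij _ _ _ _ _ _); rewrite ?subr0 ?subrr.
have F0 : 0 <= F.
  by rewrite mulr_ge0 ?invr_ge0 ?ler0n// sumr_ge0// => I _; rewrite ler0n.
have F1 : F <= 1.
  rewrite -subr_ge0 -(pmulr_rge0 _ S0) -Fsum; apply: sumr_ge0 => I _.
  by rewrite ler0n.
have k0 : 0 <= - ln a by rewrite oppr_ge0 ln_le0.
apply: le_trans (prob_accept_le_expR _ _ _ _ _ n1) _.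
rewrite -[X in X + F](@lnK _ a) ?posrE// -[ln a]opprK.
apply: le_trans (expR_chord _ _ _ k0 _); last by rewrite F0.
rewrite ler_expR lerN2.
have Cn0 : 0 <= Cn.
  have := le_trans k0 CnS; rewrite pmulr_lge0// divr_gt0//.
apply: le_trans (_ : Cn * ((size S)%:R / n%:R) * (1 - F) <= _).
  by rewrite ler_wpM2r// subr_ge0.
rewrite -mulrA ler_wpM2l// mulrAC -Fsum ler_wpM2r ?invr_ge0 ?ler0n//.
rewrite /S big_filter big_mkcond/=; apply: ler_sum => I _.
by case: (P I); rewrite ?ler0n.
Qed.

(** Chernoff's bound dominates each failure indicator by exp(t(threshold - T)), where T is linear in
    the data; [g] is the margin of the mean over the threshold. *)
Lemma prob_reject_ge (R : realType) (p : params R) (f : R -> R) (n : nat)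
    (Cn a g V t : R) (P : pred nat) (S := [seq I <- index_iota 1 n | P I]) :
  sigma p != 0 -> (1 < n)%N -> 0 < a <= 1 -> 0 < (size S)%:R :> R ->
  - ln a <= Cn * ((size S)%:R / n%:R) -> 0 <= t ->
  (forall I, I \in S -> Cthr p n Cn I I.+1 + Dthr p n I I.+1 + g <=
     \sum_(1 <= i < n.+1) contrast_weight p n I i * f (xpt R n i)) ->
  (forall I, I \in S -> \sum_(1 <= i < n.+1) contrast_weight p n I i ^+ 2 <= V) ->
  1 - a - expR (sigma p ^+ 2 / 2 * (t ^+ 2 * V) - t * g) <=
    prob_reject p f n Cn.
Proof.
move=> s0 n1 a01 S0 CnS t0 hg hV.
have S0n : (size S)%:R != 0 :> R by rewrite gt_eqF.
pose m I := \sum_(1 <= i < n.+1) contrast_weight p n I i * f (xpt R n i).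
pose th I := Cthr p n Cn I I.+1 + Dthr p n I I.+1.
(* The Chernoff bound splits into a deterministic factor [c], carrying the weight 1/|S|, and an
   exponential of the centred noise with coefficients [w]. *)
pose c I := (size S)%:R^-1 * expR (t * (th I - m I)).
pose w I i := - t * contrast_weight p n I i.
have := @gauss_expect_ge R p (fun i => f (xpt R n i)) n
  (fun Y => 1 - prob_accept p n Cn Y) (1 - a) S c w s0.
rewrite subr_ge0; case/andP: (a01) => a0 a1 /(_ a1).
have c0 j : 0 <= c j by rewrite mulr_ge0 ?invr_ge0 ?ler0n ?expR_ge0.
have acc01 Y : 0 <= 1 - prob_accept p n Cn Y <= 1.
  have /andP[? ?] := prob_accept_itv01 R p n Cn Y.
  by rewrite subr_ge0 gerBl; apply/andP.
move=> /(_ acc01 c0) H; apply: le_trans (H _) => [|Y]; last first.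
  rewrite -addrA -opprD lerB//.
  apply: le_trans (prob_accept_le_failures _ _ _ _ _ _ Y n1 a01 S0 CnS) _.
  rewrite lerD2l mulr_sumr; apply: ler_sum => I _.
  rewrite /c -mulrA ler_wpM2l ?invr_ge0 ?ler0n// -expRD.
  have [PhiI|PhiI] := boolP (Phi_ij p n Cn Y I I.+1); first exact: expR_ge0.
  (* On failure the exponent is nonnegative, so the exponential is at least 1. *)
  apply: le_trans (expR_ge1Dx _); rewrite lerDl.
  move: PhiI; rewrite /Phi_ij -ltNge fhat_contrast -/(th I) => /ltW hT.
  rewrite /w; under eq_bigr do rewrite -mulrA.
  rewrite -mulr_sumr; under eq_bigr do rewrite mulrBr.
  by rewrite sumrB -/(m I) mulNr -mulrBr mulr_ge0//; lra.
rewrite lerB//.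
apply: le_trans (_ : \sum_(I <- S) (size S)%:R^-1 *
    expR (sigma p ^+ 2 / 2 * (t ^+ 2 * V) - t * g) <= _); last first.
  by rewrite big_const_seq count_predT iter_addr_0 -[leLHS]mulr_natl mulVKf.
rewrite !big_seq; apply: ler_sum => I IS.
rewrite /c -[_ * expR _ * _]mulrA ler_wpM2l ?invr_ge0 ?ler0n// -expRD ler_expR.
rewrite addrC lerD//.
  rewrite ler_wpM2l ?divr_ge0 ?sqr_ge0//.
  under eq_bigr do rewrite /w exprMn sqrrN.
  by rewrite -mulr_sumr ler_wpM2l ?sqr_ge0// hV.
by rewrite -mulrN ler_wpM2l//; have := hg _ IS; rewrite -/(m I) -/(th I); lra.
Qed.

(** * Weights at interior grid points *)

Lemma eq_sum_nat_vanish (V : nmodType) (F : nat -> V) (a b : nat) :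
  (forall i, (minn a b <= i)%N -> F i = 0) ->
  \sum_(0 <= i < a) F i = \sum_(0 <= i < b) F i.
Proof.
wlog ab : a b / (a <= b)%N => [wl F0|].
  case: (leqP a b) => ab; first exact: wl.
  by apply/esym/wl; [exact: ltnW|move=> i; rewrite minnC; exact: F0].
move=> F0; rewrite [RHS](big_cat_nat (leq0n a) ab)//= [X in _ = _ + X]big_nat.
rewrite [X in _ = _ + X]big1 ?addr0// => i /andP[ai _]; apply: F0.
by rewrite (minn_idPl ab).
Qed.

Lemma sum_nat_itv_le (R : realType) (n a b : nat) (F : nat -> R) (c : R) :
  0 <= c -> (forall i, F i <= c) ->
  (forall i, ~~ (a <= i < b)%N -> F i = 0) ->
  \sum_(1 <= i < n.+1) F i <= c * (b - a)%:R.
Proof.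
move=> c0 Fc F0.
apply: le_trans (_ : \sum_(i <- index_iota 1 n.+1 | (a <= i < b)%N) c <= _).
  rewrite [leRHS]big_mkcond; apply: ler_sum => i _.
  by case: ifPn => [_|/F0->]//; exact: Fc.
rewrite -big_filter big_const_seq count_predT iter_addr_0 -[leLHS]mulr_natr.
rewrite ler_wpM2l// ler_nat -[leqRHS](size_iota a) uniq_leq_size//.
  by rewrite filter_uniq// iota_uniq.
by move=> i; rewrite mem_filter mem_index_iota mem_iota; lia.
Qed.

Section InteriorWeights.
Variables (R : realType) (p : params R) (n : nat) (h : R).
Hypotheses (n0 : (0 < n)%N) (h0 : 0 < h).
Hypothesis K0 : forall u, 1 <= `|u| -> K p u = 0.
Hypothesis Ksym : forall u, K p (- u) = K p u.
Hypothesis Kge0 : forall u, 0 <= K p u.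

Let nR : 0 < n%:R :> R. Proof. by rewrite ltr0n. Qed.
Let nh0 : 0 < n%:R * h. Proof. exact: mulr_gt0. Qed.

Definition kweight (I i : nat) : R := K p ((xpt R n i - xpt R n I) / h).

(** The condition h <= x_I <= 1 - h, multiplied by n to be linear in the index. *)
Definition interior_index (I : nat) : Prop :=
  n%:R * h <= I%:R :> R /\ I%:R <= n%:R - n%:R * h :> R.

Lemma kweight_arg (I i : nat) :
  (xpt R n i - xpt R n I) / h = (i%:R - I%:R) / (n%:R * h).
Proof. by rewrite /xpt -mulrBl invfM mulrA. Qed.

Lemma kweight_vanish (I i : nat) : n%:R * h <= `|i%:R - I%:R| -> kweight I i = 0.
Proof.
move=> far; rewrite /kweight kweight_arg K0// normrM normfV.
by rewrite (gtr0_norm nh0) ler_pdivlMr// mul1r.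
Qed.

Lemma kweightSS (I i : nat) : kweight I.+1 i.+1 = kweight I i.
Proof.
rewrite /kweight !kweight_arg -!natr1; congr (K p (_ / _)).
by rewrite opprD addrACA subrr addr0.
Qed.

(** If x_I = h, index 0 sits on the edge of the kernel window; there the vanishing of [K] at |u| = 1
    is used. *)
Lemma kweight0 (I : nat) : interior_index I -> kweight I 0 = 0.
Proof. by case=> nI _; apply: kweight_vanish; rewrite sub0r normrN ger0_norm. Qed.

Lemma kweightn (I : nat) : interior_index I -> kweight I n = 0.
Proof.
case=> _ nI; apply: kweight_vanish; apply: le_trans (ler_norm _); lra.
Qed.

(* At an interior grid point the design is symmetric, so the off-diagonal
   entry of the matrix of the local polynomial estimator vanishes. *)
Lemma kweight_first_moment (I : nat) : interior_index I ->
  \sum_(1 <= i < n.+1) kweight I i * ((xpt R n i - xpt R n I) / h) = 0.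
Proof.
move=> Iint; have [nI1 nI2] := Iint.
pose F i := kweight I i * ((xpt R n i - xpt R n I) / h).
have F0 : F 0%N = 0 by rewrite /F kweight0// mul0r.
have -> : \sum_(1 <= i < n.+1) F i = \sum_(0 <= i < n.+1) F i.
  by rewrite [RHS]big_nat_recl// F0 add0r big_add1.
(* The range 0..2I is centred at I; an index in only one of the two ranges is at distance at least
   nh from I and has weight zero. *)
have -> : \sum_(0 <= i < n.+1) F i = \sum_(0 <= i < I.*2.+1) F i.
  apply: eq_sum_nat_vanish => i; rewrite minnSS => iI.
  rewrite /F kweight_vanish ?mul0r//; apply: le_trans (ler_norm _).
  move: iI; rewrite gtn_min => /orP[] iI.
    have : n%:R + 1 <= i%:R :> R by rewrite natr1 ler_nat.
    lra.
  have : I.*2%:R + 1 <= i%:R :> R by rewrite natr1 ler_nat.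
  rewrite -addnn natrD; lra.
(* The reflection i -> 2I - i changes the sign of [F], as [K] is even. *)
have : \sum_(0 <= i < I.*2.+1) F i = - \sum_(0 <= i < I.*2.+1) F i.
  rewrite {1}big_nat_rev -sumrN /=; apply: eq_big_nat => i /andP[_ iI].
  rewrite add0n subSS /F /kweight !kweight_arg natrB; last by rewrite -ltnS.
  rewrite -addnn natrD.
  have -> : (I%:R + I%:R - i%:R - I%:R) / (n%:R * h) =
      - ((i%:R - I%:R) / (n%:R * h)) :> R.
    by rewrite -mulNr; congr (_ / _); ring.
  by rewrite Ksym mulrN.
by move/eqP; rewrite -addr_eq0 -mulr2n mulrn_eq0/= => /eqP.
Qed.

Definition kmass (I : nat) : R := \sum_(1 <= i < n.+1) kweight I i.

(** Since the first moment vanishes, U(0)^T is a left eigenvector, matching the row-vector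
    convention of [eigenvalue]. *)
Lemma Uvec0_Bmat (I : nat) : interior_index I ->
  (Uvec 0)^T *m Bmat p n h (xpt R n I) =
  ((n%:R * h)^-1 * kmass I) *: (Uvec 0)^T :> 'rV[R]_2.
Proof.
move=> Iint; rewrite /Bmat -scalemxAr -scalerA; congr (_ *: _).
rewrite mulmx_sumr.
under eq_bigr => i _.
  rewrite -scalemxAr mulmxA.
  rewrite (_ : (Uvec 0)^T *m Uvec _ = 1%:M); last first.
    apply/matrixP => a b; rewrite !ord1 !mxE big_ord_recl big_ord1 !mxE/=.
    by rewrite mulr1 mul0r addr0.
  rewrite mul1mx.
  rewrite (_ : (Uvec _)^T = (Uvec 0)^T + ((xpt R n i - xpt R n I) / h) *:
      (Uvec 1 - Uvec 0)^T); last first.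
    apply/rowP => a; rewrite !mxE; case: ifP => _.
      by rewrite subrr mulr0 addr0.
    by rewrite subr0 mulr1 add0r.
  rewrite scalerDr scalerA.
  over.
rewrite big_split/= -!scaler_suml.
by rewrite kweight_first_moment// scale0r addr0.
Qed.

Hypothesis lam0 : 0 < lambda0 p.

(** The eigenvalue of U(0)^T is the normalized kernel mass, hence at least [lambda0]. Inverting the
    matrix on this eigenvector reduces the local linear weights to normalized kernel weights. *)
Lemma Wn_interior (I : nat) : interior_index I ->
  (forall a, eigenvalue (Bmat p n h (xpt R n I)) a -> lambda0 p <= a) ->
  lambda0 p * (n%:R * h) <= kmass I /\
  forall i, Wn p n h (xpt R n I) i = kweight I i / kmass I.
Proof.
move=> Iint lamB; have UB := Uvec0_Bmat _ Iint.
set B := Bmat _ _ _ _ in lamB UB *.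
set b := _ * kmass I in UB.
have U0 : (Uvec 0)^T != 0 :> 'rV[R]_2.
  by apply/eqP => /rowP/(_ ord0)/eqP; rewrite !mxE/= oner_eq0.
have lb : lambda0 p <= b by apply: lamB; apply/eigenvalueP; exists (Uvec 0)^T.
have b0 : 0 < b by exact: lt_le_trans lb.
(* A nontrivial kernel would make 0 an eigenvalue, below [lambda0]. *)
have uB : B \in unitmx.
  rewrite -row_free_unit -kermx_eq0; apply/negPn/negP => kerB.
  have : lambda0 p <= 0 by apply: lamB; rewrite /eigenvalue /eigenspace raddf0 subr0.
  by rewrite leNgt lam0.
split; first by move: lb; rewrite /b mulrC ler_pdivlMr.
move=> i; rewrite /Wn -/B.
have -> : (Uvec 0)^T *m invmx B = b^-1 *: (Uvec 0)^T.
  have bn0 : b != 0 by rewrite gt_eqF.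
  by rewrite -[LHS](scalerK bn0) scalemxAl -UB mulmxK.
rewrite -scalemxAl mxE.
rewrite (_ : ((Uvec 0)^T *m Uvec _) ord0 ord0 = 1); last first.
  by rewrite mxE big_ord_recl big_ord1 !mxE/= mulr1 mul0r addr0.
rewrite -/(kweight I i) mulr1 /b [(_ * kmass I)^-1]invfM invrK mulKf ?gt_eqF//.
exact: mulrC.
Qed.

Hypothesis lamB : forall x, 0 <= x <= 1 ->
  forall a, eigenvalue (Bmat p n h x) a -> lambda0 p <= a.

Let xpt01 (I : nat) : interior_index I -> 0 <= xpt R n I <= 1.
Proof.
case=> _ nI; rewrite /xpt divr_ge0 ?ler0n//= ler_pdivrMr// mul1r.
by apply: le_trans nI _; rewrite gerBl ltW.
Qed.

Lemma kmassS (I : nat) : interior_index I -> interior_index I.+1 ->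
  kmass I.+1 = kmass I.
Proof.
move=> I0 I1; rewrite /kmass [LHS]big_add1/=.
under eq_bigr do rewrite kweightSS.
by rewrite big_ltn// kweight0// add0r [RHS]big_nat_recr//= kweightn// addr0.
Qed.

(** Shifting the index in the second sum turns the contrast into an average of F i - F (i+1) with
    nonnegative weights of total mass one, supported on |i - I| < nh. *)
Lemma contrast_mean (I : nat) (F : nat -> R) (d : R) :
  interior_index I -> interior_index I.+1 ->
  (forall i, (1 <= i < n)%N -> `|i%:R - I%:R| < n%:R * h -> d <= F i - F i.+1) ->
  d <= \sum_(1 <= i < n.+1)
    (Wn p n h (xpt R n I) i - Wn p n h (xpt R n I.+1) i) * F i.
Proof.
move=> I0 I1 dF.
have [mass0 W0] := Wn_interior _ I0 (lamB _ (xpt01 _ I0)).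
have [_ W1] := Wn_interior _ I1 (lamB _ (xpt01 _ I1)).
have kpos : 0 < kmass I.
  by apply: lt_le_trans mass0; rewrite mulr_gt0.
under eq_bigr do rewrite W0 W1 kmassS// -mulrBl mulrAC.
rewrite -mulr_suml ler_pdivlMr//.
have -> : \sum_(1 <= i < n.+1) (kweight I i - kweight I.+1 i) * F i =
    \sum_(1 <= i < n) kweight I i * (F i - F i.+1).
  have -> : \sum_(1 <= i < n.+1) (kweight I i - kweight I.+1 i) * F i =
      \sum_(1 <= i < n.+1) kweight I i * F i -
      \sum_(1 <= i < n.+1) kweight I.+1 i * F i.
    by rewrite -sumrB; apply: eq_bigr => i _; rewrite mulrBl.
  have -> : \sum_(1 <= i < n.+1) kweight I.+1 i * F i =
      \sum_(1 <= i < n) kweight I i * F i.+1.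
    rewrite big_add1/= big_ltn// kweightSS kweight0// mul0r add0r.
    by apply: eq_bigr => i _; rewrite kweightSS.
  rewrite big_nat_recr//= kweightn// mul0r addr0 -sumrB.
  by apply: eq_bigr => i _; rewrite mulrBr.
rewrite /kmass big_nat_recr//= kweightn// addr0 mulr_sumr.
apply: ler_sum_nat => i i1n; rewrite mulrC.
have [near_I|far_I] := ltP `|i%:R - I%:R| (n%:R * h).
  by rewrite ler_wpM2l ?Kge0//; exact: dF.
by rewrite kweight_vanish// !mul0r.
Qed.

(** The Lipschitz bound over one grid step and the lower bound on the mass control each term; the
    last factor bounds the number of nonzero terms. *)
Lemma contrast_sqr (I : nat) (LK : R) :
  (forall u v, `|K p u - K p v| <= LK * `|u - v|) ->
  interior_index I -> interior_index I.+1 ->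
  \sum_(1 <= i < n.+1)
    (Wn p n h (xpt R n I) i - Wn p n h (xpt R n I.+1) i) ^+ 2 <=
  (LK / (n%:R * h) / (lambda0 p * (n%:R * h))) ^+ 2 * (2 * (n%:R * h) + 2).
Proof.
move=> lip I0 I1.
have [mass0 W0] := Wn_interior _ I0 (lamB _ (xpt01 _ I0)).
have [_ W1] := Wn_interior _ I1 (lamB _ (xpt01 _ I1)).
have lnh : 0 < lambda0 p * (n%:R * h) by rewrite mulr_gt0.
have kpos : 0 < kmass I by apply: lt_le_trans mass0.
set c := _ / (lambda0 p * _).
pose M := ceil_nat (n%:R * h).
have M0 : n%:R * h <= M%:R := ceil_nat_ge _ _.
have M1 : M%:R < n%:R * h + 1 := ceil_nat_lt _ _ (ltW nh0).
have LK0 : 0 <= LK.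
  by have := le_trans (normr_ge0 _) (lip 0 1); rewrite sub0r normrN normr1 mulr1.
have wc i : `|kweight I i / kmass I - kweight I.+1 i / kmass I| <= c.
  rewrite -mulrBl normrM normfV (gtr0_norm kpos).
  apply: ler_pM => //; first by rewrite invr_ge0 ltW.
    rewrite /kweight !kweight_arg; apply: le_trans (lip _ _) _.
    rewrite -mulrBl normrM normfV (gtr0_norm nh0) mulrA.
    rewrite ler_pM2r ?invr_gt0// -natr1.
    rewrite (_ : i%:R - I%:R - _ = 1); last by ring.
    by rewrite normr1 mulr1.
  by rewrite lef_pV2 ?posrE.
have c0 : 0 <= c by exact: le_trans (normr_ge0 _) (wc 0%N).
(* The half-open window from I+1-M to I+1+M covers the supports of both weights, centred at I and at
   I+1. *)
apply: le_trans (@sum_nat_itv_le R n (I.+1 - M) (I.+1 + M) _ (c ^+ 2) _ _ _) _.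
- exact: sqr_ge0.
- by move=> i; rewrite W0 W1 kmassS// -real_normK ?num_real// ler_pXn2r ?nnegrE// ?wc.
- move=> i; rewrite negb_and -!leqNgt => ifar.
  rewrite W0 W1 !kweight_vanish ?mul0r ?subrr ?expr0n//.
    move: ifar => /orP[].
      rewrite -ltnNge => iM.
      have : i%:R + M%:R + 1 <= I%:R + 1 :> R.
        by rewrite -natrD !natr1 ler_nat; lia.
      move=> ?; rewrite distrC; apply: le_trans (ler_norm _); rewrite -natr1; lra.
    move=> iM; have : I%:R + 1 + M%:R <= i%:R :> R by rewrite natr1 -natrD ler_nat; lia.
    move=> ?; apply: le_trans (ler_norm _); rewrite -natr1; lra.
  move: ifar => /orP[].
    rewrite -ltnNge => iM.
    have : i%:R + M%:R + 1 <= I%:R + 1 :> R.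
      by rewrite -natrD !natr1 ler_nat; lia.
    move=> ?; rewrite distrC; apply: le_trans (ler_norm _); lra.
  move=> iM; have : I%:R + 1 + M%:R <= i%:R :> R by rewrite natr1 -natrD ler_nat; lia.
  move=> ?; apply: le_trans (ler_norm _); lra.
rewrite ler_wpM2l ?sqr_ge0//.
apply: le_trans (_ : (M + M)%:R <= _); first by rewrite ler_nat; lia.
by rewrite natrD; lra.
Qed.

End InteriorWeights.
Arguments interior_index {R}.

(** * Counting candidates *)

(** The underlying outer measure is monotone on arbitrary subsets; this is applied to the set D. *)
Lemma le_lebesgue_measure (R : realType) (A B : set (measurableTypeR R)) :
  A `<=` B -> (lebesgue_measure A <= lebesgue_measure B)%E.
Proof.
rewrite /lebesgue_measure /lebesgue_stieltjes_measure /measure_extension.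
by move=> AB; apply: (@le_mu_ext _ (ocitv_type R) R _ A B AB).
Qed.

(** By the mean value theorem the decrement is -f'(c)/n with c within 4h of x, and the variation of
    f' is at most L(4h)^(beta-1) <= 4L h^(beta-1), as beta - 1 <= 1. *)
Lemma decrement_ge (R : realType) (p : params R) (f : R -> R) (n i : nat)
    (h gam x : R) :
  1 < beta p <= 2 -> 0 < L p -> Hoelder_class p f -> 0 < h -> (i < n)%N ->
  Dset gam f x -> `|xpt R n i - x| + n%:R^-1 <= 4 * h ->
  (gam - 4 * L p * h `^ (beta p - 1)) / n%:R <= f (xpt R n i) - f (xpt R n i.+1).
Proof.
move=> /andP[b1 b2] L0 [fd fH] h0 ltin [x01 fx] near_x.
have n0 : 0 < n%:R :> R by rewrite ltr0n (leq_ltn_trans _ ltin).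
have step : xpt R n i.+1 - xpt R n i = n%:R^-1.
  by rewrite /xpt -mulrBl -natr1 addrAC subrr add0r mul1r.
have lt01 : xpt R n i < xpt R n i.+1 by rewrite -subr_gt0 step invr_gt0.
have drv y : y \in `]xpt R n i, xpt R n i.+1[ -> is_derive y 1 f (derive1 f y).
  by move=> _; rewrite derive1E; apply: DeriveDef.
have fc : {within `[xpt R n i, xpt R n i.+1], continuous f}.
  apply: derivable_within_continuous => y _; exact: fd.
have [c cin Ec] := MVT lt01 drv fc.
have /andP[c0 c1] : xpt R n i < c < xpt R n i.+1 by move: cin; rewrite in_itv.
have cx : `|c - x| <= 4 * h.
  apply: le_trans near_x; rewrite (_ : c - x = xpt R n i - x + (c - xpt R n i)); last by ring.
  apply: le_trans (ler_normD _ _) _; rewrite lerD2l -step.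
  by rewrite ger0_norm ?subr_ge0 ?lerD2r ltW.
have c01 : c \in `[0, 1].
  rewrite in_itv /= (le_trans _ (ltW c0)) ?divr_ge0 ?ler0n//=.
  rewrite (le_trans (ltW c1))// /xpt ler_pdivrMr// mul1r ler_nat//.
have hb : L p * `|c - x| `^ (beta p - 1) <= 4 * L p * h `^ (beta p - 1).
  rewrite [4 * _]mulrC -mulrA ler_wpM2l ?(ltW L0)//.
  apply: le_trans (_ : (4 * h) `^ (beta p - 1) <= _).
    by rewrite ge0_ler_powR ?nnegrE ?subr_ge0 ?(ltW b1)// mulr_ge0 ?(ltW h0).
  rewrite powRM ?(ltW h0)// ler_wpM2r ?powR_ge0//.
  by rewrite ler1_powR ?ler1n//; lra.
have := le_trans (ler_norm _) (le_trans (fH c x c01 x01) hb).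
move=> dc.
have {}dc : derive1 f c <= - (gam - 4 * L p * h `^ (beta p - 1)) by lra.
rewrite -[leRHS]opprB Ec step -[leRHS]mulNr ler_wpM2r ?invr_ge0 ?ler0n//.
by rewrite lerNr.
Qed.

Section CandidateCount.
Variables (R : realType) (n : nat) (h : R) (D : set (measurableTypeR R)).
Hypotheses (nh6 : 6 <= n%:R * h) (h16 : h <= 16^-1).
Hypothesis D01 : D `<=` [set x | 0 <= x <= 1].

(** The radius 5h/2, the kernel window h and one grid step of at most h/2 add up to the 4h allowed
    for the variation of f'. *)
Definition candidate (I : nat) : bool :=
  `[< interior_index n h I /\ interior_index n h I.+1 /\
      exists2 x, D x & `|x - xpt R n I| <= 5 / 2 * h >].

Definition candidates : seq nat := [seq I <- index_iota 1 n | candidate I].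

Let n0 : 0 < n%:R :> R.
Proof.
rewrite lt0r ler0n andbT; apply/eqP => n0; move: nh6.
by rewrite n0 mul0r; apply/negP; rewrite -ltNge.
Qed.

Let h0 : 0 < h.
Proof. by rewrite -(pmulr_rgt0 _ n0); apply: lt_le_trans nh6. Qed.

Let xptE I : xpt R n I * n%:R = I%:R.
Proof. by rewrite /xpt divfK// gt_eqF. Qed.

Let dist_scaled x I : `|x - xpt R n I| * n%:R = `|x * n%:R - I%:R|.
Proof. by rewrite -{1}(gtr0_norm n0) -normrM mulrBl xptE. Qed.

Lemma candidate_in_range I : interior_index n h I -> interior_index n h I.+1 ->
  I \in index_iota 1 n.
Proof.
have nh6' := nh6; move=> [I1 _] [_ I2]; rewrite mem_index_iota.
apply/andP; split.
  have : 0 < I%:R :> R by lra.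
  by rewrite ltr0n.
have : I%:R < n%:R :> R by move: I2; rewrite -natr1; lra.
by rewrite ltr_nat.
Qed.

Lemma candidatesP I : candidate I -> I \in candidates.
Proof.
move=> cI; rewrite mem_filter cI; case/asboolP: cI => [I1 [I2 _]].
exact: candidate_in_range.
Qed.

(** The count 2nh + 2 is n times the total length of the two boundary strips, so the candidates near
    one point compensate for the part of D lost there. *)
Lemma size_candidates_ge x : D x -> h + 1 / n%:R <= x <= 1 - h - 1 / n%:R ->
  2 * (n%:R * h) + 2 <= (size candidates)%:R.
Proof.
have nh6' := nh6; move=> Dx /andP[x0 x1].
have {}x0 : n%:R * h + 1 <= x * n%:R.
  have := ler_wpM2r (ltW n0) x0.
  by rewrite mulrDl div1r mulVf ?gt_eqF// [h * _]mulrC.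
have {}x1 : x * n%:R <= n%:R - n%:R * h - 1.
  have := ler_wpM2r (ltW n0) x1.
  by rewrite !mulrBl !mul1r mulVf ?gt_eqF// [h * _]mulrC.
have nh16 : n%:R * h * 16 <= n%:R.
  by rewrite -mulrA -[leRHS]mulr1 ler_pM2l// -ler_pdivlMr// mul1r.
(* Left end of a window of 5nh/2 in index scale, placed on the side of x facing 1/2; h <= 1/16 keeps
   it interior. *)
pose c := if x <= 2^-1 then x * n%:R else x * n%:R - 5 / 2 * (n%:R * h).
have cI y : c <= y <= c + 5 / 2 * (n%:R * h) ->
    [/\ n%:R * h <= y, y + 1 <= n%:R - n%:R * h &
       `|x * n%:R - y| <= 5 / 2 * (n%:R * h)].
  rewrite /c ler_norml; case: ifPn => [xle|]; last rewrite -ltNge => xgt.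
    have : x * n%:R <= 2^-1 * n%:R by rewrite ler_pM2r.
    by move=> ? /andP[? ?]; split; lra.
  have : 2^-1 * n%:R < x * n%:R by rewrite ltr_pM2r.
  by move=> ? /andP[? ?]; split; lra.
have c0 : 0 <= c by have [|] := cI c; first (by rewrite lexx lerDl; lra); lra.
pose i0 := ceil_nat c.
have i0c : c <= i0%:R := ceil_nat_ge _ _.
have i0c1 : i0%:R < c + 1 := ceil_nat_lt _ _ c0.
(* Since nh >= 6, M > 5nh/2 - 1 >= 2nh + 2. *)
pose M := Num.truncn (5 / 2 * (n%:R * h)).
have /andP[M0 M1] : M%:R <= 5 / 2 * (n%:R * h) < M.+1%:R.
  by apply: truncn_itv; lra.
apply: le_trans (_ : M%:R <= _); first by move: M1; rewrite -natr1; lra.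
rewrite ler_nat -[leqLHS](size_iota i0) uniq_leq_size ?iota_uniq// => i.
rewrite mem_iota => /andP[i0i iM].
apply: candidatesP.
have ic : c <= i%:R <= c + 5 / 2 * (n%:R * h).
  have : i0%:R <= i%:R :> R by rewrite ler_nat.
  have : i%:R + 1 <= i0%:R + M%:R :> R by rewrite natr1 -natrD ler_nat.
  by move=> ? ?; apply/andP; split; lra.
have [ni i1 near_x] := cI _ ic.
apply/asboolP; split; first by split; lra.
split; first by rewrite /interior_index -natr1; split; lra.
exists x => //; rewrite -(ler_pM2r n0).
by rewrite dist_scaled (_ : 5 / 2 * h * n%:R = 5 / 2 * (n%:R * h)) //; ring.
Qed.

Let cell I : set (measurableTypeR R) := `[xpt R n I, xpt R n I.+1]%classic.

Let measure_cells (s : seq nat) :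
  (lebesgue_measure (\big[setU/set0]_(I <- s) cell I) <=
   ((size s)%:R / n%:R)%:E)%E.
Proof.
elim: s => [|I s IH]; first by rewrite big_nil measure0 mul0r.
rewrite big_cons; apply: le_trans (measureU2 _ _ _) _.
- exact: measurable_itv.
- by apply: bigsetU_measurable => i _; exact: measurable_itv.
rewrite /= -natr1 mulrDl addrC EFinD; apply: leeD => //.
rewrite /cell lebesgue_measure_itv /=.
rewrite lte_fin /xpt ltr_pM2r ?invr_gt0// ltr_nat ltnSn -EFinD lee_fin.
by rewrite -mulrBl -natr1 addrAC subrr add0r.
Qed.

(* Outside two boundary intervals of length h+1/n, D is covered by the cells
   starting at candidates. *)
Lemma lebesgue_measure_le_candidates :
  (lebesgue_measure D <=
   (2 * (h + 1 / n%:R) + (size candidates)%:R / n%:R)%:E)%E.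
Proof.
have nh6' := nh6; have h0' := h0.
pose B0 : set (measurableTypeR R) := `[0, h + 1 / n%:R]%classic.
pose B1 : set (measurableTypeR R) := `[1 - (h + 1 / n%:R), 1]%classic.
pose C := \big[setU/set0]_(I <- candidates) cell I.
have mC : measurable C by apply: bigsetU_measurable => i _; exact: measurable_itv.
have r0 : 0 < h + 1 / n%:R by rewrite addr_gt0// divr_gt0.
have DB : D `<=` (B0 `|` B1) `|` C.
  move=> x Dx; have /andP[x0 x1] := D01 x Dx.
  have [xl|xl] := leP x (h + 1 / n%:R).
    by left; left; rewrite /B0 /= in_itv/= x0.
  have [xr|xr] := leP (1 - (h + 1 / n%:R)) x.
    by left; right; rewrite /B1 /= in_itv/= x1 xr.
  right.
  have xn0 : 0 <= x * n%:R by rewrite mulr_ge0.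
  have {}xl : n%:R * h + 1 < x * n%:R.
    move: xl; rewrite -(ltr_pM2r n0).
    by rewrite mulrDl div1r mulVf ?gt_eqF// [h * _]mulrC.
  have {}xr : x * n%:R < n%:R - (n%:R * h + 1).
    move: xr; rewrite -(ltr_pM2r n0).
    by rewrite mulrBl mulrDl !mul1r mulVf ?gt_eqF// [h * _]mulrC.
  (* The strips have length h + 1/n, so rounding down leaves both I and I+1 interior. *)
  pose I := Num.truncn (x * n%:R).
  have /andP[I0 I1] : I%:R <= x * n%:R < I.+1%:R by exact: truncn_itv.
  have cellI : cell I x.
    by rewrite /cell /= in_itv/= /xpt ler_pdivrMr// I0 ler_pdivlMr// ltW.
  rewrite /C -bigcup_seq; exists I => //=.
  apply: candidatesP; apply/asboolP; rewrite -natr1 in I1.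
  split; first by split; lra.
  split; first by rewrite /interior_index -natr1; split; lra.
  exists x => //; rewrite -(ler_pM2r n0).
  rewrite dist_scaled (_ : 5 / 2 * h * n%:R = 5 / 2 * (n%:R * h)); last by ring.
  by rewrite ger0_norm; lra.
apply: le_trans (le_lebesgue_measure _ _ _ DB) _.
apply: le_trans (measureU2 _ _ _) _ => //.
  by apply: measurableU; exact: measurable_itv.
rewrite EFinD; apply: leeD; last exact: measure_cells.
apply: le_trans (measureU2 _ _ _) _; [exact: measurable_itv..|].
have mu0 : lebesgue_measure B0 = (h + 1 / n%:R)%:E.
  by rewrite /B0 lebesgue_measure_itv /= lte_fin r0 oppr0 adde0.
have mu1 : lebesgue_measure B1 = (h + 1 / n%:R)%:E.
  by rewrite /B1 lebesgue_measure_itv /= lte_fin gtrBl r0 -EFinB subKr.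
by rewrite /= mu0 mu1 -EFinD lee_fin mulr_natl mulr2n.
Qed.

End CandidateCount.

(** * Asymptotics *)

Section Constants.
Variables (R : realType) (p : params R).
Hypotheses (hbeta : 1 < beta p <= 2) (L0 : 0 < L p) (s0 : 0 < sigma p).
Hypotheses (kern : kernel_assumptions p) (lam0 : 0 < lambda0 p).

Local Notation b := (2 * beta p + 1).

Let b0 : 0 < b.
Proof. by have /andP[? ?] := hbeta; lra. Qed.

(** The Lipschitz property extends vanishing from |u| > 1 to |u| = 1: a positive value there would
    persist slightly further out. *)
Lemma kernel_vanish u : 1 <= `|u| -> K p u = 0.
Proof.
have [Kge0 [_ [Ksupp [_ [_ [[LK0 lip] _]]]]]] := kern.
move=> u1; apply/eqP; rewrite eq_le Kge0 andbT leNgt; apply/negP => Ku.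
have LK1 : 0 < LK p + 1 by rewrite ltr_wpDl.
have [d d0 Kd] : exists2 d, 0 < d & LK p * d < K p u.
  exists (K p u / (LK p + 1)); first by rewrite divr_gt0.
  by rewrite mulrA ltr_pdivrMr// mulrC ltr_pM2l// ltrDl.
have u0 : 0 < `|u| by exact: lt_le_trans u1.
have := lip u (u / `|u| * (`|u| + d)).
have -> : K p (u / `|u| * (`|u| + d)) = 0.
  apply: Ksupp; rewrite normrM normrM normfV normr_id divff ?gt_eqF// mul1r.
  by rewrite ger0_norm ?addr_ge0 ?ltW// -[X in X < _]addr0 ler_ltD.
rewrite subr0 gtr0_norm// (_ : u - _ = - (u / `|u| * d)); last first.
  by rewrite mulrDr divfK ?gt_eqF// opprD addrA subrr sub0r.
rewrite normrN !normrM normfV normr_id divff ?gt_eqF// mul1r (gtr0_norm d0).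
by apply/negP; rewrite -ltNge.
Qed.

(** Squared multiples of indicators bound K^2 on both sides; the upper one gives finiteness, without
    which [fine] could return 0. *)
Lemma mu2_gt0 : 0 < mu2 p.
Proof.
have [Kge0 [_ [Ksupp [[Kmin0 [Kmax0 Delta0]] [Kbd _]]]]] := kern.
pose lo (u : R) := Kmin p ^+ 2 * \1_(`[- Delta p, Delta p]%classic : set R) u.
pose hi (u : R) := Kmax p ^+ 2 * \1_(`[-1, 1]%classic : set R) u.
have intE (c a : R) : 0 < a -> (\int[lebesgue_measure]_u
    (c ^+ 2 * \1_(`[- a, a]%classic : set R) u)%:E = (c ^+ 2 * (2 * a))%:E)%E.
  move=> a0; under eq_integral do rewrite EFinM.
  rewrite ge0_integralZl//; last 2 first.
  - by apply/measurable_EFinP; exact: measurable_indic.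
  - by rewrite lee_fin sqr_ge0.
  rewrite integral_indic//= setIT lebesgue_measure_itv/= lte_fin gtrN// -EFinB.
  by rewrite -EFinM opprK -mulr2n mulr_natl.
have lo_le : ((Kmin p ^+ 2 * (2 * Delta p))%:E <=
    \int[lebesgue_measure]_u (K p u ^+ 2)%:E)%E.
  rewrite -intE//; apply: ge0_le_integral_nonmeas => u; rewrite lee_fin.
    by rewrite mulr_ge0 ?sqr_ge0.
  have [+ _] := Kbd u; rewrite indicE mem_setE in_itv/= -ler_norml.
  case: ifP => _ Ku; last by rewrite mulr0 sqr_ge0.
  by rewrite mulr1 ler_pXn2r ?nnegrE ?(ltW Kmin0)//; rewrite mulr1 in Ku.
have hi_ge : (\int[lebesgue_measure]_u (K p u ^+ 2)%:E <=
    (Kmax p ^+ 2 * (2 * 1))%:E)%E.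
  rewrite -intE//; apply: ge0_le_integral_nonmeas => u; rewrite lee_fin ?sqr_ge0//.
  rewrite indicE mem_setE in_itv/= -ler_norml.
  have [u1|u1] := leP `|u| 1; last by rewrite Ksupp// expr0n mulr0.
  by rewrite mulr1 ler_pXn2r ?nnegrE ?(ltW Kmax0)//; have [_] := Kbd u.
rewrite /mu2 /Rintegral -lte_fin fineK; last first.
  rewrite ge0_fin_numE; first exact: le_lt_trans hi_ge (ltry _).
  by apply: integral_ge0 => u _; rewrite lee_fin sqr_ge0.
by apply: lt_le_trans lo_le; rewrite lte_fin !mulr_gt0// exprn_gt0.
Qed.

Lemma Ch_gt0 : 0 < Ch p.
Proof.
have [_ [_ [_ [[_ [Kmax0 _]] _]]]] := kern.
have /andP[b1 _] := hbeta.
have q1_gt0 : 0 < q1 p by rewrite /q1 /Cstar !mulr_gt0// invr_gt0.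
rewrite powR_gt0// divr_gt0//.
  by rewrite /q2 divr_gt0 ?exprn_gt0// mulr_gt0 ?mu2_gt0// mulr_gt0 ?exprn_gt0.
by apply: mulr_gt0; [rewrite mulr_gt0 ?exprn_gt0|exact: lt_trans b1].
Qed.

Lemma L2_gt0 : 0 < L2 p.
Proof.
have [_ [_ [_ [[_ [Kmax0 _]] [_ [[LK0 _] _]]]]]] := kern.
by rewrite /L2 ltr_pwDl ?mulr_gt0// mulr_ge0.
Qed.

Lemma Wc_gt0 : 0 < Wc p.
Proof.
have [_ [_ [_ [[_ [Kmax0 _]] _]]]] := kern.
by rewrite /Wc lt_max mulr_gt0// exprn_gt0// /Cstar divr_gt0// mulr_gt0.
Qed.

Local Notation B := (Ch p `^ b).

Lemma Ch_powR_gt0 : 0 < B.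
Proof. by rewrite powR_gt0 ?Ch_gt0. Qed.

(* C_beta = 4 L + slope: the term 4 L pays for the variation of f' over a
   window of radius 4 h_n, and slope / 2 for the threshold. *)
Definition slope : R :=
  16 * L2 p * sigma p / lambda0 p * Num.sqrt (4 * Wc p / B).

Lemma slope_gt0 : 0 < slope.
Proof.
rewrite /slope mulr_gt0 ?sqrtr_gt0 ?divr_gt0 ?mulr_gt0 ?L2_gt0 ?Wc_gt0 ?Ch_powR_gt0//.
Qed.

Section FixedSampleSize.
Variables (n : nat).
Hypothesis n1 : (1 < n)%N.

Local Notation y := (ln (n%:R : R)).
Local Notation h := (hn p n).

Let nR : 0 < n%:R :> R. Proof. by rewrite ltr0n ltnW. Qed.
Let y0 : 0 < y. Proof. by rewrite ln_gt0// ltr1n. Qed.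

Lemma hn_gt0 : 0 < h.
Proof. by rewrite mulr_gt0 ?Ch_gt0// powR_gt0// divr_gt0. Qed.

(** The balance defining the bandwidth: n h^(2beta+1) is proportional to log n. *)
Lemma hn_powR : n%:R * h `^ b = B * y.
Proof.
rewrite /hn powRM ?powR_ge0 ?(ltW Ch_gt0)// -powRrM mulVf ?gt_eqF//.
rewrite powRr1 ?divr_ge0 ?ltW// mulrCA; congr (_ * _).
by rewrite mulrC divfK ?gt_eqF.
Qed.

(** The exponent 3 + 2(beta-1) separates the variance scale h^3 from the squared slope. *)
Lemma hn_powR_split : h `^ b = h ^+ 3 * (h `^ (beta p - 1)) ^+ 2.
Proof.
rewrite -!powR_mulrn ?powR_ge0 ?(ltW hn_gt0)// -powRrM -powRD.
  by congr (_ `^ _); ring.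
by apply/implyP => _; rewrite gt_eqF ?hn_gt0.
Qed.

(** As alpha/Nmax >= n^(-2), the logarithmic factor is at most 4 log n; the first term of the
    minimum, at distance 1/n, then gives half the slope since 8 = 16/2. *)
Lemma Cthr_le (Cn : R) (I : nat) :
  0 < alpha p -> 0 < Nmax n Cn <= alpha p * n%:R ^+ 2 ->
  Cthr p n Cn I I.+1 <= slope / 2 * h `^ (beta p - 1) / n%:R.
Proof.
move=> al0 /andP[N0 NaN].
have lnle : - 2 * ln (alpha p / Nmax n Cn) * Wc p <= 4 * Wc p * y.
  rewrite [leRHS]mulrAC ler_wpM2r ?(ltW Wc_gt0)//.
  have : - ln (alpha p / Nmax n Cn) <= 2 * y; last lra.
  rewrite -lnV ?posrE ?divr_gt0// invf_div mulr_natl -lnXn//.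
  rewrite ler_ln ?posrE ?divr_gt0 ?exprn_gt0//.
  by rewrite ler_pdivrMr// mulrC.
(* Here log n is traded for n h^b / B; the powers of n cancel and b/2 - 3/2 = beta - 1. *)
have sq : Num.sqrt (4 * Wc p * y) * n%:R `^ (- 2^-1) * h `^ (- (3 / 2)) =
    Num.sqrt (4 * Wc p / B) * h `^ (beta p - 1).
  rewrite (_ : 4 * Wc p * y = 4 * Wc p / B * (n%:R * h `^ b)); last first.
    by rewrite hn_powR mulrA divfK// gt_eqF ?Ch_powR_gt0.
  rewrite sqrtrM; last by rewrite divr_ge0 ?mulr_ge0 ?(ltW Wc_gt0) ?(ltW Ch_powR_gt0).
  rewrite -!mulrA; congr (_ * _).
  rewrite -(@powR12_sqrt _ (n%:R * _)); last first.
    by rewrite mulr_ge0 ?ler0n ?powR_ge0.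
  rewrite powRM ?ler0n ?powR_ge0// -powRrM powRN.
  rewrite mulrACA divff ?mul1r; last by rewrite gt_eqF ?powR_gt0.
  rewrite -powRD; last by apply/implyP => _; rewrite gt_eqF ?hn_gt0.
  by congr (_ `^ _); field.
have dist : `|xpt R n I - xpt R n I.+1| = n%:R^-1.
  by rewrite distrC /xpt -mulrBl -natr1 addrAC subrr add0r mul1r ger0_norm.
apply: le_trans (_ : sigma p * (Num.sqrt (4 * Wc p * y) * n%:R `^ (- 2^-1) *
    h `^ (- (3 / 2))) * (8 * L2 p / lambda0 p * n%:R^-1) <= _).
  rewrite /Cthr [sigma p * (_ * _ * _)]mulrA [sigma p * (_ * _)]mulrA.
  apply: ler_pM.
  + by rewrite !mulr_ge0 ?powR_ge0 ?sqrtr_ge0 ?(ltW s0).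
  + by rewrite le_min (ltW hn_gt0) mulr_ge0// divr_ge0 ?mulr_ge0 ?(ltW L2_gt0) ?(ltW lam0).
  + by rewrite !ler_wpM2r ?powR_ge0// ler_wpM2l ?(ltW s0)// ler_wsqrtr.
  + by rewrite dist ge_min lexx.
rewrite sq /slope le_eqVlt; apply/orP; left; apply/eqP.
by field; rewrite !gt_eqF.
Qed.

(** The choice t = tau/g makes the linear term tau, while V/g^2 is of order 1/log n. With 2nh + 2 <=
    3nh the constant is 6 = (3/2) * 4, the 4 coming from the halved slope in g. *)
Lemma noise_ratio (l tau : R)
    (g := slope / 2 * h `^ (beta p - 1) / n%:R) (t := tau / g)
    (V := (l / (n%:R * h) / (lambda0 p * (n%:R * h))) ^+ 2 *
          (2 * (n%:R * h) + 2)) :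
  6 <= n%:R * h ->
  tau ^+ 2 * (6 * sigma p ^+ 2 * (l / (lambda0 p * slope)) ^+ 2 / B) <= y ->
  sigma p ^+ 2 / 2 * (t ^+ 2 * V) - t * g <= 1 - tau.
Proof.
move=> nh6 ylarge; rewrite /t.
have u0 : 0 < h `^ (beta p - 1) by rewrite powR_gt0 ?hn_gt0.
have g0 : 0 < g.
  by rewrite /g divr_gt0// mulr_gt0// divr_gt0// slope_gt0.
rewrite divfK ?gt_eqF// lerD2r.
apply: le_trans (_ : sigma p ^+ 2 / 2 * ((tau / g) ^+ 2 *
  ((l / (n%:R * h) / (lambda0 p * (n%:R * h))) ^+ 2 * (3 * (n%:R * h)))) <= _).
  rewrite ler_wpM2l ?divr_ge0 ?sqr_ge0// ler_wpM2l ?sqr_ge0//.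
  rewrite ler_wpM2l ?sqr_ge0//; lra.
have := ylarge; rewrite -(ler_pM2l Ch_powR_gt0) -hn_powR hn_powR_split /g.
set u := h `^ _ in u0 *.
move=> H.
have D0 : 0 < n%:R * (h ^+ 3 * u ^+ 2) 
  by rewrite mulr_gt0// mulr_gt0// exprn_gt0// hn_gt0.
have sl := slope_gt0; have hh := hn_gt0; have BB := Ch_powR_gt0.
rewrite (_ : _ / 2 * _ = B * (tau ^+ 2 * (6 * sigma p ^+ 2 *
  (l / (lambda0 p * slope)) ^+ 2 / B)) / (n%:R * (h ^+ 3 * u ^+ 2))).
  by rewrite ler_pdivrMr// mul1r.
by field; rewrite !gt_eqF.
Qed.

End FixedSampleSize.
End Constants.

(** * Power at a fixed large sample size and passage to the limit *)

Lemma prob_reject_large (R : realType) (p : params R) (f : R -> R) (n : nat)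
    (h := hn p n) (y := ln (n%:R : R)) (eps := eps1 (gamman p n) f)
    (kap := - ln (alpha p / 2)) :
  1 < beta p <= 2 -> 0 < L p -> 0 < sigma p -> kernel_assumptions p ->
  0 < lambda0 p -> 0 < alpha p < 1 -> Hoelder_class p f -> (1 < n)%N ->
  (forall x, x \in `[0, 1] ->
     forall a, eigenvalue (Bmat p n h x) a -> lambda0 p <= a) ->
  ((2 / n%:R)%:E <= eps)%E ->
  Dset (gamman p n) f `&` `[h + 1 / n%:R, 1 - h - 1 / n%:R] !=set0 ->
  6 <= n%:R * h -> h <= 16^-1 ->
  40 / ln 2 * kap * y ^+ 2 <= alpha p * n%:R ->
  (1 + kap) ^+ 2 * (6 * sigma p ^+ 2 * (LK p / (lambda0 p * slope R p)) ^+ 2 /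
     Ch p `^ (2 * beta p + 1)) <= y ->
  1 - alpha p <=
    prob_reject p f n (- 2 * ln (alpha p / 2) / fine eps).
Proof.
move=> hbeta L0 s0 kern lam0 /andP[al0 al1] fH n1 lamB epsge [xs [Dxs xsint]].
move=> nh6 h16 Nlarge ylarge.
have h0 : 0 < h := hn_gt0 _ _ hbeta L0 s0 kern lam0 _ n1.
have nR : 0 < n%:R :> R by rewrite ltr0n ltnW.
have [Kge0 [_ [_ [_ [_ [[LK0 lip] Ksym]]]]]] := kern.
have kap0 : 0 < kap by rewrite oppr_gt0 ln_lt0// ; lra.
pose D : set (measurableTypeR R) := Dset (gamman p n) f.
have D01 : D `<=` [set x | 0 <= x <= 1] by move=> x [+ _]; rewrite in_itv.
pose S := candidates R n h D.
have Sge : 2 * (n%:R * h) + 2 <= (size S)%:R.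
  by apply: (size_candidates_ge R n h D nh6 h16 xs Dxs); move: xsint; rewrite /= in_itv.
have S0 : 0 < (size S)%:R :> R by lra.
have epsle := lebesgue_measure_le_candidates R n h D nh6 D01.
have epsfin : eps \is a fin_num.
  rewrite ge0_fin_numE; first exact: le_lt_trans epsle (ltry _).
  by apply: le_trans epsge; rewrite lee_fin divr_ge0.
have e2 : 2 / n%:R <= fine eps by rewrite -lee_fin fineK.
have e0 : 0 < fine eps by apply: lt_le_trans e2; rewrite divr_gt0.
(* The boundary strips account for 2nh + 2 <= |S|, so n eps <= 2|S|. *)
have eS : fine eps * n%:R <= 2 * (size S)%:R.
  have : fine eps <= 2 * (h + 1 / n%:R) + (size S)%:R / n%:R.
    by rewrite -lee_fin fineK.
  rewrite -(ler_pM2r nR) => /le_trans; apply.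
  rewrite (_ : _ * n%:R = 2 * (n%:R * h) + 2 + (size S)%:R); first lra.
  by field; rewrite gt_eqF.
set Cn := _ / fine eps.
have CnE : Cn = 2 * kap / fine eps by rewrite /Cn mulNr mulrN.
have Cn0 : 0 < Cn by rewrite CnE divr_gt0// mulr_gt0.
(* From eps >= 2/n; this keeps [Nmax] below alpha n^2. *)
have Cnle : Cn <= kap * n%:R.
  rewrite CnE ler_pdivrMr// -mulrA [2 * _]mulrC ler_wpM2l ?(ltW kap0)//.
  by move: e2; rewrite ler_pdivrMr// mulrC.
have ln20 : 0 < ln 2 :> R by rewrite ln_gt0// ltr1n.
have y0 : 0 < y by rewrite ln_gt0// ltr1n.
have NmaxP : 0 < Nmax n Cn <= alpha p * n%:R ^+ 2.
  rewrite /Nmax -/y; apply/andP; split.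
    apply: mulr_gt0; last exact: exprn_gt0.
    by apply: mulr_gt0 => //; exact: divr_gt0.
  apply: le_trans (_ : 40 / ln 2 * (kap * n%:R) * y ^+ 2 <= _).
    apply: ler_wpM2r; first exact: sqr_ge0.
    by rewrite ler_wpM2l// divr_ge0// ltW.
  have -> : 40 / ln 2 * (kap * n%:R) * y ^+ 2 = 40 / ln 2 * kap * y ^+ 2 * n%:R.
    by ring.
  by rewrite [n%:R ^+ 2]expr2 [leRHS]mulrA ler_wpM2r// ltW.
(* Bounds the threshold at candidates; the mean contrast reaches 2g, leaving a margin g. *)
pose g := slope R p / 2 * h `^ (beta p - 1) / n%:R.
have sl0 : 0 < slope R p := slope_gt0 _ _ hbeta L0 s0 kern lam0.
have g0 : 0 < g by rewrite /g divr_gt0// mulr_gt0 ?powR_gt0// divr_gt0.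
pose V := (LK p / (n%:R * h) / (lambda0 p * (n%:R * h))) ^+ 2 *
          (2 * (n%:R * h) + 2).
(* With tau = 1 + kap the Chernoff exponent is at most 1 - tau = ln(alpha/2), so both error terms
   are at most alpha/2. *)
pose t := (1 + kap) / g.
have K0 := kernel_vanish _ _ kern.
have lamB' x : 0 <= x <= 1 ->
    forall a, eigenvalue (Bmat p n h x) a -> lambda0 p <= a.
  by move=> x01; apply: lamB; rewrite in_itv.
have interior_itv I : interior_index n h I -> xpt R n I \in `[h, 1 - h].
  move=> [I1 I2]; rewrite in_itv /= /xpt ler_pdivlMr// ler_pdivrMr// mulrBl mul1r.
  by rewrite ![h * _]mulrC I1.
have nr := noise_ratio _ _ hbeta L0 s0 kern lam0 n n1 (LK p) (1 + kap) nh6 ylarge.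
rewrite -/h -/g -/V -/t opprD addrA subrr add0r opprK in nr.
have expo : expR (sigma p ^+ 2 / 2 * (t ^+ 2 * V) - t * g) <= alpha p / 2.
  apply: le_trans (_ : expR (ln (alpha p / 2)) <= _); first by rewrite ler_expR.
  by rewrite lnK// posrE divr_gt0.
apply: (@le_trans _ _ (1 - alpha p / 2 -
  expR (sigma p ^+ 2 / 2 * (t ^+ 2 * V) - t * g))).
  by move: expo; lra.
apply: (prob_reject_ge R p f n Cn (alpha p / 2) g V t (candidate R n h D)) => //.
- by rewrite gt_eqF.
- by apply/andP; split; lra.
- rewrite -/kap CnE -/(candidates R n h D) -/S.
  have aux (a c d e : R) : 2 * a / c * (d / e) = a * (2 * d / (c * e)).
    by rewrite invfM; ring.
  rewrite aux.
  by rewrite ler_peMr ?(ltW kap0)// ler_pdivlMr ?mul1r// mulr_gt0.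
- by rewrite divr_ge0 ?(ltW g0)//; lra.
- move=> I; rewrite mem_filter => /andP[/asboolP[I0 [I1 [x Dx near_x]]] _].
  have Ct := Cthr_le _ _ hbeta L0 s0 kern lam0 n n1 Cn I al0 NmaxP.
  rewrite /Dthr !interior_itv//= addr0.
  apply: le_trans (_ : g + g <= _); first by rewrite lerD2r.
  have n0 : (0 < n)%N by exact: ltnW.
  apply: (contrast_mean R p n h n0 h0 K0 Ksym Kge0 lam0 lamB' I
    (fun i => f (xpt R n i)) _ I0 I1) => i /andP[i1 ilt] near_I.
  (* Removing 4L from [Cbeta] leaves slope h^(beta-1)/n = g + g. *)
  apply: le_trans (decrement_ge R p f n i h (gamman p n) x hbeta L0 fH h0 ilt Dx _).
    rewrite /gamman /Cbeta -/(slope R p) -mulrBl addrAC subrr add0r /g.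
    by rewrite le_eqVlt; apply/orP; left; apply/eqP; field; rewrite gt_eqF.
  have nV : n%:R^-1 <= h / 2.
    by rewrite -[leLHS]mul1r ler_pdivrMr// mulrAC ler_pdivlMr//; lra.
  have xiI : `|xpt R n i - xpt R n I| <= h.
    rewrite /xpt -mulrBl normrM normfV (gtr0_norm nR) ler_pdivrMr// mulrC.
    exact: ltW.
  have := ler_normD (xpt R n i - xpt R n I) (xpt R n I - x).
  rewrite addrA subrK [`|xpt R n I - x|]distrC => ?; lra.
- move=> I; rewrite mem_filter => /andP[/asboolP[I0 [I1 _]] _].
  have n0 : (0 < n)%N by exact: ltnW.
  exact: (contrast_sqr R p n h n0 h0 K0 Ksym lam0 lamB' I (LK p) lip I0 I1).
Qed.

Lemma le_limn_einf (R : realType) (u : nat -> \bar R) (l : \bar R) (N : nat) :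
  (forall n, (N <= n)%N -> (l <= u n)%E) -> (l <= limn_einf u)%E.
Proof.
move=> lu; rewrite limn_einf_lim.
have -> : limn (einfs u) = ereal_sup (range (einfs u)).
  by apply/cvg_lim => //; exact: cvg_einfs_sup.
apply: le_trans (_ : einfs u N <= _)%E; last by apply: ereal_sup_ubound; exists N.
by apply: le_ereal_inf_tmp => _ [n /= Nn <-]; exact: lu.
Qed.

Theorem mainTheorem6 (R : realType) (p : params R) (f : nat -> R -> R) (N0 : nat) :
  1 < beta p <= 2 -> 0 < L p -> 0 < sigma p ->
  kernel_assumptions p -> lambda0_assumption p ->
  0 < alpha p < 1 ->
  (forall n : nat, (1 <= n)%N -> Hoelder_class p (f n)) ->
  (forall n : nat, (N0 <= n)%N ->
     ((2 / n%:R)%:E <= eps1 (gamman p n) (f n))%E /\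
     (Dset (gamman p n) (f n) `&`
        `[hn p n + 1 / n%:R, 1 - hn p n - 1 / n%:R] !=set0)) ->
  ((1 - alpha p)%:E <=
     limn_einf (fun n : nat =>
       (prob_reject p (f n) n
          (- 2 * ln (alpha p / 2) / fine (eps1 (gamman p n) (f n))))%:E))%E.
Proof.
move=> hbeta L0 s0 kern [lam0 [N1 lamB]] al fH feps.
have /andP[al0 al1] := al; have /andP[b1 b2] := hbeta.
set b := 2 * beta p + 1.
have b0 : 0 < b by rewrite /b; lra.
pose B := Ch p `^ b.
have B0 : 0 < B := Ch_powR_gt0 _ _ hbeta L0 s0 kern lam0.
pose kap := - ln (alpha p / 2).
(* Lower bounds on log n giving, in order, h <= 1/16, nh >= 6, the bound on [Nmax] and a Chernoff
   quadratic term of at most 1. The 2 in [Y1] and the 6 in [Y3] are 2! and 3!. *)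
pose Y1 := 2 * B / 16^-1 `^ b.
pose Y2 := 6 / B.
pose Y3 := 6 * (40 / ln 2 * kap) / alpha p.
pose Y4 := (1 + kap) ^+ 2 *
  (6 * sigma p ^+ 2 * (LK p / (lambda0 p * slope R p)) ^+ 2 / B).
pose Y := Num.max (Num.max Y1 Y2) (Num.max Y3 Y4).
pose N2 := ceil_nat (expR Y).
apply: (le_limn_einf _ _ _ (maxn (maxn N0 N1) (maxn 2 N2))) => n.
rewrite !geq_max => /andP[/andP[nN0 nN1] /andP[n1 nN2]].
rewrite lee_fin; have [epsge Dint] := feps n nN0.
have nR : 0 < n%:R :> R by rewrite ltr0n ltnW.
pose y := ln (n%:R : R).
have y0 : 0 < y by rewrite ln_gt0// ltr1n.
have yY : Y <= y.
  rewrite -[Y]expRK ler_ln ?posrE ?expR_gt0//.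
  by apply: le_trans (ceil_nat_ge _ _) _; rewrite ler_nat.
move: yY; rewrite /Y !ge_max => /andP[/andP[Y1y Y2y] /andP[Y3y Y4y]].
(* One term of the exponential series: (log n)^m <= m! n. *)
have yn k : y ^+ k.+1 / k.+1`!%:R <= n%:R.
  rewrite -[leRHS](@lnK _ n%:R) ?posrE//.
  by apply: le_trans (expR_ge1Dxn k (ltW y0)); rewrite -/y lerDr.
have h0 : 0 < hn p n := hn_gt0 _ _ hbeta L0 s0 kern lam0 _ n1.
have hb := hn_powR _ _ hbeta _ n1.
have h16 : hn p n <= 16^-1.
  (* Otherwise n/16^b < n h^b = B log n, whereas (log n)^2 <= 2n and log n >= [Y1] give the
     reverse. *)
  rewrite leNgt; apply/negP => hbig.
  have : 16^-1 `^ b < hn p n `^ b by rewrite gt0_ltr_powR ?nnegrE ?(ltW h0).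
  rewrite -(ltr_pM2l nR) hb -/B -/y; apply/negP; rewrite -leNgt.
  move: Y1y; rewrite /Y1 ler_pdivrMr ?powR_gt0// => H.
  have := yn 1%N; rewrite (_ : 2`! = 2)%N// ler_pdivrMr// => H2.
  have Hn : B * y * y <= y * 16^-1 `^ b * n%:R.
    apply: le_trans (_ : 2 * B * n%:R <= _); last by rewrite ler_wpM2r// ltW.
    have -> : 2 * B * n%:R = B * (n%:R * 2) by ring.
    by rewrite -mulrA ler_wpM2l ?(ltW B0).
  rewrite -(ler_pM2r y0); apply: le_trans Hn _.
  by rewrite le_eqVlt; apply/orP; left; apply/eqP; ring.
apply: prob_reject_large => //; first exact: fH (ltnW n1).
- by move=> x x01; apply: lamB.
(* As h <= 1 and b >= 1, nh >= n h^b = B log n >= 6. *)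
- apply: le_trans (_ : n%:R * hn p n `^ b <= _).
    by rewrite hb -/B -/y mulrC -ler_pdivrMr.
  rewrite ler_wpM2l ?ler0n// ge1r_powR//; last by rewrite /b; lra.
  by rewrite h0 (le_trans h16)//; lra.
- have := yn 2%N; rewrite (_ : 3`! = 6)%N// ler_pdivrMr// -/kap -/y => y3.
  move: Y3y; rewrite /Y3 ler_pdivrMr// => H3.
  have six : 0 < 6 :> R by [].
  rewrite -(ler_pM2l six); apply: le_trans (_ : alpha p * y ^+ 3 <= _).
    rewrite (_ : alpha p * y ^+ 3 = (y * alpha p) * y ^+ 2); last by ring.
    by rewrite mulrA ler_wpM2r// sqr_ge0.
  by rewrite [leRHS]mulrCA ler_wpM2l ?(ltW al0)// mulrC.
Qed.
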